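(* Let $V$ be a valuation ring with maximal ideal $\mathfrak{m}$, and let $W$ be a local and flat $V$-algebra with maximal ideal $\mathfrak{n}$. Assume that: (i) $\mathfrak{n}=\mathfrak{m}W$; (ii) $W$ is the colimit of a filtered inductive system $(R_i)_{i\in I}$ of flat $V$-algebras essentially of finite type, whose transition morphisms $u_{i,j}:R_i\to R_j$ $(i\le j)$ are flat. Then $W$ is a weakly unramified extension of $V$.
   Context: Rings are commutative with unit. A local $V$-algebra is a $V$-algebra that is a local ring as a ring. The value group of a valuation ring $V$ with fraction field $K$ is the totally ordered abelian group $K^\times/V^\times$. An extension of a valuation ring $V$ is an injective local homomorphism $j:V\to W$ with $W$ a valuation ring; it induces an injective increasing homomorphism $|j|:\Gamma\to\Delta$ between the value groups of $V$ and $W$. The extension $j$ (or $W$) is called weakly unramified if $|j|$ is an isomorphism. *)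

(* Defs.v *)
From HB Require Import structures.
From mathcomp Require Import all_boot all_order all_algebra generic_quotient.
From mathcomp Require Import boolp.

Set Implicit Arguments.
Unset Strict Implicit.
Unset Printing Implicit Defensive.

Import GRing.Theory.
Local Open Scope ring_scope.
Local Open Scope quotient_scope.

Notation "x %:F" := (@FracField.tofrac _ x) (at level 1, format "x %:F").

(* Ideals are boolean predicates, as in ring_quotient, where [idealr_closed]
   includes properness.  Boolean predicates are as general as Prop-valued ones
   since [boolp] makes every proposition decidable. *)
Definition maximal_ideal (A : comNzRingType) (m : {pred A}) : Prop :=
  idealr_closed m /\
  forall J : {pred A}, idealr_closed J -> {subset m <= J} -> J =i m.

Definition local_ring (A : comNzRingType) (m : {pred A}) : Prop :=
  maximal_ideal m /\ forall m' : {pred A}, maximal_ideal m' -> m' =i m.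

(* Membership in the extension I B of an ideal I of A to an A-algebra B. *)
Definition in_extended_ideal (A : comNzRingType) (B : comAlgType A)
    (I : {pred A}) (b : B) : Prop :=
  exists s : seq (A * B),
    all (fun p => p.1 \in I) s /\ b = \sum_(p <- s) p.1 *: p.2.

(* T, with b : N x M -> T, is a tensor product of N and M over A. *)
Definition is_tensor (A : comNzRingType) (N M T : lmodType A)
    (b : {bilinear N -> M -> T}) : Prop :=
  forall (P : lmodType A) (c : {bilinear N -> M -> P}),
    exists2 h : {linear T -> P},
      forall x y, h (b x y) = c x y &
      forall h' : {linear T -> P}, (forall x y, h' (b x y) = c x y) -> h' =1 h.

(* Tensoring with M preserves injectivity; g below is f (x) id_M. *)
Definition flat (A : comNzRingType) (M : lmodType A) : Prop :=
  forall (N' N : lmodType A) (f : {linear N' -> N}), injective f ->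
  forall (T' T : lmodType A)
         (b' : {bilinear N' -> M -> T'}) (b : {bilinear N -> M -> T}),
    is_tensor b' -> is_tensor b ->
  forall g : {linear T' -> T},
    (forall x y, g (b' x y) = b (f x) y) -> injective g.

(* B seen as an A-module through phi. *)
Definition restr_scalars (A B : comNzRingType) (phi : {rmorphism A -> B}) : Type
  := B.

Section RestrScalars.
Variables (A B : comNzRingType) (phi : {rmorphism A -> B}).
Local Notation M := (restr_scalars phi).

HB.instance Definition _ := GRing.Zmodule.on M.

Let rscale (a : A) (x : M) : M := (phi a * x : B).

Fact rscaleA a b v : rscale a (rscale b v) = rscale (a * b) v.
Proof. by rewrite /rscale mulrA rmorphM. Qed.

Fact rscale1 : left_id 1 rscale.
Proof. by move=> v; rewrite /rscale rmorph1 mul1r. Qed.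

Fact rscaleDr : right_distributive rscale +%R.
Proof. by move=> a u v; exact: mulrDr. Qed.

Fact rscaleDl v : {morph rscale^~ v : a b / a + b}.
Proof. by move=> a b; rewrite /rscale rmorphD; exact: mulrDl. Qed.

HB.instance Definition _ :=
  GRing.Zmodule_isLmodule.Build A M rscaleA rscale1 rscaleDr rscaleDl.
End RestrScalars.

Definition flat_hom (A B : comNzRingType) (phi : {rmorphism A -> B}) : Prop :=
  flat (restr_scalars phi).

Definition finite_type (A : comNzRingType) (C : comAlgType A) : Prop :=
  exists s : seq C, forall S : {pred C},
    GRing.subalg_closed S -> {subset s <= S} -> forall x, x \in S.

(* B, with phi : C -> B, is the ring of fractions S^-1 C. *)
Definition is_localization (C B : comNzRingType) (S : {pred C})
    (phi : {rmorphism C -> B}) : Prop :=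
  [/\ {in S, forall s, exists b : B, b * phi s = 1},
      forall b : B, exists c s, s \in S /\ b * phi s = phi c &
      forall c c' : C, phi c = phi c' <-> exists2 s, s \in S & s * c = s * c'].

Definition ess_finite_type (A : comNzRingType) (B : comAlgType A) : Prop :=
  exists (C : comAlgType A) (S : {pred C}) (phi : {lrmorphism C -> B}),
    [/\ finite_type C, GRing.mulr_closed S & is_localization S phi].

(* Inductive systems of A-algebras over a preordered set, and their colimits. *)
Record inductive_system (A : comNzRingType) (d : Order.disp_t)
    (I : preorderType d) := InductiveSystem {
  sys_obj :> I -> comAlgType A;
  sys_map : forall i j, (i <= j)%O -> {lrmorphism sys_obj i -> sys_obj j};
  sys_map_id : forall i (le_ii : (i <= i)%O), sys_map le_ii =1 id;
  sys_map_comp : forall i j k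
    (le_ij : (i <= j)%O) (le_jk : (j <= k)%O) (le_ik : (i <= k)%O),
    sys_map le_jk \o sys_map le_ij =1 sys_map le_ik }.

Definition filtered (d : Order.disp_t) (I : preorderType d) : Prop :=
  inhabited I /\ forall i j : I, exists k : I, (i <= k)%O /\ (j <= k)%O.

Section Colimit.
Variables (A : comNzRingType) (d : Order.disp_t) (I : preorderType d).
Variable F : inductive_system A I.

Definition is_cocone (B : comAlgType A) (f : forall i, {lrmorphism F i -> B})
    : Prop :=
  forall i j (le_ij : (i <= j)%O), f j \o sys_map F le_ij =1 f i.

Definition is_colimit (B : comAlgType A) (f : forall i, {lrmorphism F i -> B})
    : Prop :=
  is_cocone f /\
  forall (C : comAlgType A) (g : forall i, {lrmorphism F i -> C}),
    is_cocone g ->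
    exists2 h : {lrmorphism B -> C},
      forall i, h \o f i =1 g i &
      forall h' : {lrmorphism B -> C}, (forall i, h' \o f i =1 g i) -> h' =1 h.
End Colimit.

Definition valuation_ring (V : idomainType) : Prop :=
  forall x : {fraction V}, x != 0 ->
    (exists a : V, x = a%:F) \/ (exists a : V, x^-1 = a%:F).

(* The group K^* / V^*, for V a domain with fraction field K. *)
Section ValueGroup.
Variable V : idomainType.

Local Notation nzfrac := {x : {fraction V} | x != 0}.

Implicit Types x y z : nzfrac.

Definition nzfrac1 : nzfrac := exist _ 1 (oner_neq0 _).

Definition nzfracM x y : nzfrac :=
  exist _ (val x * val y) (mulf_neq0 (valP x) (valP y)).

Definition nzfracV x : nzfrac := exist _ (val x)^-1 (invr_neq0 (valP x)).

Definition vequiv x y : bool :=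
  `[< exists2 u : V, u \is a GRing.unit & val x = u%:F * val y >].

Fact vequiv_refl : reflexive vequiv.
Proof.
by move=> x; apply/asboolP; exists 1; rewrite ?unitr1 // rmorph1 mul1r.
Qed.

Fact vequiv_sym : symmetric vequiv.
Proof.
suff imp x y : vequiv x y -> vequiv y x by move=> x y; apply/idP/idP; exact: imp.
move=> /asboolP[u Uu e]; apply/asboolP; exists u^-1; first by rewrite unitrV.
by rewrite e mulrA -rmorphM mulVr // rmorph1 mul1r.
Qed.

Fact vequiv_trans : transitive vequiv.
Proof.
move=> y x z /asboolP[u Uu e] /asboolP[v Uv e']; apply/asboolP.
by exists (u * v); rewrite ?unitrMl // e e' mulrA rmorphM.
Qed.

Canonical vequiv_equiv := EquivRel vequiv vequiv_refl vequiv_sym vequiv_trans.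

Definition value_group := {eq_quot vequiv}.

HB.instance Definition _ : EqQuotient _ vequiv value_group :=
  EqQuotient.on value_group.
HB.instance Definition _ := Choice.on value_group.

Definition vclass x : value_group := \pi_value_group x.

Lemma vclassK a : vclass (repr a) = a.
Proof. exact: reprK. Qed.

Lemma vclass_eq x y : vclass x = vclass y <-> vequiv x y.
Proof. by split=> [/eqmodP|?] //; apply/eqmodP. Qed.

Lemma vclassW (P : value_group -> Prop) : (forall x, P (vclass x)) -> forall a, P a.
Proof. by move=> Px a; rewrite -[a]vclassK. Qed.

(* [repr] picks a representative of a class; the choice is immaterial by
   [vmul_pi], [vinv_pi] and [vle_pi]. *)
Definition vmul (a b : value_group) : value_group :=
  vclass (nzfracM (repr a) (repr b)).

Definition vinv (a : value_group) : value_group :=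
  vclass (nzfracV (repr a)).

Lemma vequiv_repr x : vequiv (repr (vclass x)) x.
Proof. exact/vclass_eq/vclassK. Qed.

Lemma vmul_pi x y : vmul (vclass x) (vclass y) = vclass (nzfracM x y).
Proof.
apply/vclass_eq/asboolP => /=.
have /asboolP[u Uu ->] := vequiv_repr x; have /asboolP[v Uv ->] := vequiv_repr y.
by exists (u * v); rewrite ?unitrMl // rmorphM mulrACA.
Qed.

Lemma vinv_pi x : vinv (vclass x) = vclass (nzfracV x).
Proof.
apply/vclass_eq/asboolP => /=; have /asboolP[u Uu ->] := vequiv_repr x.
exists u^-1; rewrite ?unitrV // invfM; congr (_ * _).
by rewrite [RHS]rmorphV.
Qed.

Fact vmulA : associative vmul.
Proof.
elim/vclassW=> x; elim/vclassW=> y; elim/vclassW=> z; rewrite !vmul_pi.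
by congr vclass; apply: val_inj; rewrite /= mulrA.
Qed.

Fact vmulC : commutative vmul.
Proof.
elim/vclassW=> x; elim/vclassW=> y; rewrite !vmul_pi.
by congr vclass; apply: val_inj; rewrite /= mulrC.
Qed.

Fact vmul1 : left_id (vclass nzfrac1) vmul.
Proof.
elim/vclassW=> x; rewrite vmul_pi.
by congr vclass; apply: val_inj; rewrite /= mul1r.
Qed.

Fact vmulV : left_inverse (vclass nzfrac1) vinv vmul.
Proof.
elim/vclassW=> x; rewrite vinv_pi vmul_pi.
by congr vclass; apply: val_inj; rewrite /= mulVf ?(valP x).
Qed.

Fact vmulr1 : right_id (vclass nzfrac1) vmul.
Proof. by move=> a; rewrite vmulC vmul1. Qed.

Fact vmulrV : right_inverse (vclass nzfrac1) vinv vmul.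
Proof. by move=> a; rewrite vmulC vmulV. Qed.

HB.instance Definition _ :=
  isGroup.Build value_group vmulA vmul1 vmulr1 vmulV vmulrV.

(* The class of x is at most that of y when y / x lies in V. *)
Definition vle (a b : value_group) : bool :=
  `[< exists c : V, val (repr b) = c%:F * val (repr a) >].

Lemma vle_pi x y :
  vle (vclass x) (vclass y) <-> exists c : V, val y = c%:F * val x.
Proof.
have /asboolP[u Uu ex] := vequiv_repr x; have /asboolP[v Uv ey] := vequiv_repr y.
split=> [/asboolP|] [c]; rewrite ?ex ?ey => e.
  exists (v^-1 * c * u); rewrite !rmorphM -!mulrA -e mulrA -rmorphM mulVr //.
  by rewrite rmorph1 mul1r.
apply/asboolP; exists (v * c * u^-1).
rewrite ex ey e !rmorphM -!mulrA; do 2!congr (_ * _).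
by rewrite mulrA -rmorphM mulVr // rmorph1 mul1r.
Qed.

End ValueGroup.

Section Extension.
Variables (V W : idomainType) (j : {rmorphism V -> W}).

(* Both V and W are meant to be local here. *)
Definition local_hom : Prop :=
  forall (m : {pred V}) (n : {pred W}), maximal_ideal m -> maximal_ideal n ->
  forall a, a \in m -> j a \in n.

Definition is_extension : Prop :=
  [/\ valuation_ring V, valuation_ring W, injective j & local_hom].

(* The map between fraction fields induced by an injective j. *)
Definition frac_map (x : {fraction V}) : {fraction W} :=
  (j \n_(repr x))%:F / (j \d_(repr x))%:F.

Lemma fracE (x : {fraction V}) : x = (\n_(repr x))%:F / (\d_(repr x))%:F.
Proof.
have d0 : (\d_(repr x))%:F != 0 by rewrite tofrac_eq0 denom_ratioP.
apply: (mulIf d0); rewrite divfK //.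
move: (repr x) (reprK x) => [[a b] /= b0] <- {d0}.
rewrite !piE; apply/eqmodP; rewrite /= FracField.equivfE /FracField.mulf.
by rewrite !numden_Ratio ?mulf_neq0 ?oner_eq0 //= !mulr1 mulrC.
Qed.

Lemma frac_mapE (a b : V) : injective j -> b != 0 ->
  frac_map (a%:F / b%:F) = (j a)%:F / (j b)%:F.
Proof.
move=> j_inj b0; rewrite /frac_map; set x := a%:F / b%:F.
have j0 c : c != 0 -> (j c)%:F != 0.
  by move=> c0; rewrite tofrac_eq0 -(rmorph0 j) (inj_eq j_inj).
have F0 (c : V) : c != 0 -> c%:F != 0 by rewrite tofrac_eq0.
have d0 := denom_ratioP (repr x).
have /eqP := fracE x.
rewrite {1}/x eqr_div ?F0 // -!rmorphM tofrac_eq => /eqP e.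
by apply/eqP; rewrite eqr_div ?j0 // -!rmorphM e.
Qed.

Lemma frac_map_neq0 (x : {fraction V}) :
  injective j -> x != 0 -> frac_map x != 0.
Proof.
move=> j_inj x0; rewrite /frac_map mulf_neq0 ?invr_eq0 //.
  rewrite tofrac_eq0 -(rmorph0 j) (inj_eq j_inj).
  by apply: contraNneq x0 => n0; rewrite [x]fracE n0 rmorph0 mul0r.
by rewrite tofrac_eq0 -(rmorph0 j) (inj_eq j_inj) denom_ratioP.
Qed.

(* The map |j| induced by an injective j on value groups; the default value of
   [insubd] is not used, by [frac_map_neq0], and the choice of [repr] is
   immaterial, by [value_group_mapE]. *)
Definition value_group_map (a : value_group V) : value_group W :=
  vclass (insubd (nzfrac1 W) (frac_map (val (repr a)))).

Lemma value_group_mapE (x : {x : {fraction V} | x != 0}) : injective j ->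
  value_group_map (vclass x) =
  vclass (insubd (nzfrac1 W) (frac_map (val x))).
Proof.
move=> j_inj; apply/vclass_eq/asboolP.
have /asboolP[u Uu ex] := vequiv_repr x.
exists (j u); first exact: rmorph_unit.
rewrite !val_insubd !frac_map_neq0 ?(valP x) ?(valP (repr (vclass x))) //.
rewrite ex; have [a [b [b0 ->]]] : exists a b : V, b != 0 /\ val x = a%:F / b%:F.
  exists \n_(repr (val x)), \d_(repr (val x)).
  by split; [exact: denom_ratioP | exact: fracE].
by rewrite mulrA -rmorphM !frac_mapE // !rmorphM mulrA.
Qed.

Definition ordered_group_iso (f : value_group V -> value_group W) : Prop :=
  [/\ bijective f,
      {morph f : a b / (a * b)%g} &
      {mono f : a b / vle a b}].

Definition weakly_unramified : Prop :=
  is_extension /\ ordered_group_iso value_group_map.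

End Extension.

Definition idomain_of (A : comUnitRingType) (dom : GRing.integral_domain_axiom A)
    : idomainType :=
  HB.pack (GRing.ComUnitRing.sort A)
    (GRing.ComUnitRing_isIntegral.Build A dom).

(* Main.v *)
Require Import Defs.
From HB Require Import structures.
From mathcomp Require Import all_boot all_order all_algebra.
From mathcomp Require Import generic_quotient boolp.
From mathcomp Require wochoice.
From mathcomp Require Import ring zify.

Set Implicit Arguments.
Unset Strict Implicit.
Unset Printing Implicit Defensive.

Import GRing.Theory.
Local Open Scope ring_scope.
Local Open Scope quotient_scope.

(** Everything follows from one property of [W], proved in [colimit_content]:
    a nonzero element of [W] is a product of an element of [V] and of a unit
    (its content and its primitive part).  As [W] is torsion-free over [V],
    it is then a domain in which divisibility reduces to divisibility in [V];
    hence it is a valuation ring with the value group of [V]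
    ([content_unramified]).

    To find the content of [x], replace [W] by the image [A] of an algebra of
    finite type over [V], filtered by the degree in its generators.  The pieces
    [S d] are finitely generated and torsion-free, hence free over [V], and by
    Hilbert's argument the associated graded ring is noetherian modulo [m]
    ([generated_filtration]).  Flatness of the transition maps and [n = m W]
    are used together in [locally_in_max]: an element of [A] which lies in [n]
    is carried into [m A] by an element of [A] outside [n].

    Let [x] be in [S h], let [C] be the set of the elements of [V] dividing [x]
    in [W], and suppose that no quotient [x / b] with [b] in [C] is a unit.
    Since [n = m W], the set [C] has no largest element.  For [b] in [C] let
    [N b] be the graded ideal of the [z] such that [b] divides [x z] inside the
    filtration.  Elementary divisors over [V] ([divisor_lattice]) show that in
    each degree, when [b] is far enough in [C], every [z] in [N b] is modulo
    [m] an element of [F1]: some element of [V] outside [C] divides [x z].  The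
    quotient [x z / b] lies in a graded ideal [F2].  Neither [F1] nor [F2]
    depends on [b]; both are contained in [n], and both are finitely generated
    modulo [m].  So a single [e] outside [n] carries their generators into the
    multiples of [m].  Lifting these generators to [N b], one gets finitely many
    elements of [N b] generating an ideal of [W] equal to its product with [n];
    it vanishes by Nakayama's lemma, although it contains [b] itself, a
    contradiction ([content_contradiction]). *)

(** * Spans and lattices over a valuation ring *)

Section Span.
Variables (V : comNzRingType) (Q : lmodType V).
Implicit Types (l : seq Q) (P : Q -> Prop).

Definition submodP P : Prop :=
  P 0 /\ forall (v : V) x y, P x -> P y -> P (v *: x + y).

(** Defined as an intersection of submodules, so that a property of a span is
    proved by exhibiting a submodule; coefficients appear in [lspan_nth]. *)
Definition lspan l (x : Q) : Prop :=
  forall P, submodP P -> {in l, forall y, P y} -> P x.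

Lemma submodD P x y : submodP P -> P x -> P y -> P (x + y).
Proof. by case=> _ h Px Py; rewrite -[x]scale1r; exact: h. Qed.

Lemma submodZ P v x : submodP P -> P x -> P (v *: x).
Proof. by case=> P0 h Px; rewrite -[_ *: x]addr0; exact: h. Qed.

Lemma submodB P x y : submodP P -> P x -> P y -> P (x - y).
Proof. by move=> sP Px Py; rewrite addrC -scaleN1r; case: sP => _; apply. Qed.

Lemma submod_sum P (I : Type) (r : seq I) (F : I -> Q) :
  submodP P -> (forall i, P (F i)) -> P (\sum_(i <- r) F i).
Proof.
move=> sP PF; elim: r => [|i r IHr]; first by rewrite big_nil; case: sP.
by rewrite big_cons; exact: submodD.
Qed.

Lemma lspan_submod l : submodP (lspan l).
Proof.
split=> [P [P0 _] //|v x y hx hy P sP hl].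
by case: (sP) => _; apply; [exact: hx | exact: hy].
Qed.

Lemma mem_lspan l y : y \in l -> lspan l y.
Proof. by move=> ly P _; exact. Qed.

Lemma lspan_sub l P : submodP P -> {in l, forall y, P y} ->
  forall x, lspan l x -> P x.
Proof. by move=> sP hl x; exact. Qed.

Lemma lspan_cons y l x : lspan (y :: l) x -> exists v x', lspan l x' /\ x = v *: y + x'.
Proof.
move=> h; apply: (h (fun x => exists v x', lspan l x' /\ x = v *: y + x')).
  split; first by exists 0, 0; rewrite scale0r addr0; split=> //; case: (lspan_submod l).
  move=> v _ _ [v1 [x1 [h1 ->]]] [v2 [x2 [h2 ->]]].
  exists (v * v1 + v2), (v *: x1 + x2); split.
    by case: (lspan_submod l) => _; apply.
  by rewrite scalerDr scalerDl scalerA addrACA.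
move=> z; rewrite inE => /orP[/eqP->|lz].
  exists 1, 0; rewrite scale1r addr0; split=> //; by case: (lspan_submod l).
by exists 0, z; rewrite scale0r add0r; split=> //; exact: mem_lspan.
Qed.

Lemma lspan_nil x : lspan [::] x -> x = 0.
Proof. by move/(_ (fun x => x = 0)); apply=> //; split=> // v _ _ -> ->; rewrite scaler0 addr0. Qed.

Lemma lspan_nth l x : lspan l x ->
  exists c : 'I_(size l) -> V, x = \sum_i c i *: l`_i.
Proof.
elim: l x => [|y l IHl] x.
  by move/lspan_nil=> ->; exists (fun=> 0); rewrite big_ord0.
case/lspan_cons=> v [x' [/IHl[c ->] ->]].
exists (fun i => if unlift ord0 i is Some j then c j else v).
rewrite big_ord_recl /= unlift_none; congr (_ + _).
by apply: eq_bigr => i _; rewrite liftK.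
Qed.
End Span.

Lemma finite_choice (A : eqType) (B : Type) (l : seq A) (Q : A -> B -> Prop) :
  {in l, forall a, exists b, Q a b} -> (exists b : B, True) ->
  exists g : A -> B, {in l, forall a, Q a (g a)}.
Proof.
move=> h [b0 _]; have h' a : exists b, a \in l -> Q a b.
  by case la: (a \in l); [have [b] := h a la; exists b | exists b0].
by exists (fun a => sval (cid (h' a))) => a la; exact: (svalP (cid (h' a))).
Qed.

Section ValuationRing.
Variables (V : idomainType) (m : {pred V}).
Hypotheses (V_val : valuation_ring V) (V_max : maximal_ideal m).

(** The form in which the valuation ring axiom is used: the fraction field does
    not appear any more. *)
Lemma dvd_total (a b : V) : (exists c, a = b * c) \/ (exists c, b = a * c).
Proof.
case: (eqVneq a 0) => [->|a0]; first by left; exists 0; rewrite mulr0.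
case: (eqVneq b 0) => [->|b0]; first by right; exists 0; rewrite mulr0.
have F0 (c : V) : c != 0 -> c%:F != 0 by rewrite tofrac_eq0.
have /V_val[[c e]|[c e]] : a%:F / b%:F != 0 by rewrite mulf_neq0 ?invr_eq0 ?F0.
- left; exists c; apply/eqP; rewrite -tofrac_eq rmorphM /= -e mulrC divfK //.
  exact: F0.
- right; exists c; apply/eqP; rewrite -tofrac_eq rmorphM /= -e invf_div mulrC divfK //.
  exact: F0.
Qed.

Lemma max0 : 0 \in m. Proof. by case: V_max => -[]. Qed.
Lemma max1 : 1 \notin m. Proof. by case: V_max => -[]. Qed.
Lemma maxM a u : u \in m -> a * u \in m.
Proof. by case: V_max => -[m0 _ h] _ mu; rewrite -[_ * _]addr0 h. Qed.
Lemma maxMr a u : u \in m -> u * a \in m.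
Proof. by rewrite mulrC; exact: maxM. Qed.
(** Nonunits form an ideal because divisibility is total; it contains [m], so
    maximality of [m] gives equality. *)
Lemma max_unit u : (u \in m) = (u \isn't a GRing.unit).
Proof.
apply/idP/idP => [mu|nu].
  by apply/negP => Uu; move: max1; rewrite -(mulVr Uu) maxM.
pose J : {pred V} := [pred x | x \isn't a GRing.unit].
have JE x : (x \in J) = (x \isn't a GRing.unit) by [].
have mJ : {subset m <= J}.
  move=> x mx; rewrite JE; apply/negP => Ux.
  by move: max1; rewrite -(mulVr Ux) maxM.
case: V_max => _ /(_ J) <- //.
split=> [||a x y]; rewrite !JE ?unitr0 ?unitr1 // => nx ny.
have [[c ec]|[c ec]] := dvd_total x y.
  by rewrite ec mulrCA -[in X in _ + X](mulr1 y) -mulrDr unitrM (negPf ny).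
by rewrite ec mulrC -mulrDr unitrM (negPf nx).
Qed.

(** Failure of divisibility is strict divisibility the other way. *)
Lemma dvd_max (a b : V) : (exists c, a = b * c) \/ (exists2 t, t \in m & b = a * t).
Proof.
have [?|[c e]] := dvd_total a b; first by left.
case mc: (c \in m); first by right; exists c.
left; exists c^-1; rewrite e mulrK //.
by move/negbT: mc; rewrite max_unit negbK.
Qed.

(** This lets sums of multiples of elements of [m] be factored through a single
    element of [m]. *)
Lemma max_gcd (a b : V) : a \in m -> b \in m ->
  exists2 t, t \in m & (exists c, a = t * c) /\ exists c, b = t * c.
Proof.
move=> ma mb; have [e|e] := dvd_total a b.
  by exists b => //; split=> //; exists 1; rewrite mulr1.
by exists a => //; split=> //; exists 1; rewrite mulr1.
Qed.

Lemma seq_gcd (l : seq V) : l != [::] ->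
  exists2 b, b \in l & {in l, forall a, exists c, a = b * c}.
Proof.
elim: l => // a [|a' l] IHl _.
  by exists a; rewrite ?mem_head // => x; rewrite inE => /eqP->; exists 1; rewrite mulr1.
have [//|b lb hb] := IHl.
have [[c ac]|[c ac]] := dvd_total a b.
  exists b; first by rewrite inE lb orbT.
  by move=> x; rewrite inE => /orP[/eqP->|/hb //]; exists c.
exists a; rewrite ?mem_head // => x; rewrite inE => /orP[/eqP->|/hb[d ->]].
  by exists 1; rewrite mulr1.
by exists (c * d); rewrite ac mulrA.
Qed.

Section Modules.
Variable Q : lmodType V.
Hypothesis torsionfree : forall (a : V) (x : Q), a *: x = 0 -> a = 0 \/ x = 0.

Lemma scale_inj (a : V) (x y : Q) : a != 0 -> a *: x = a *: y -> x = y.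
Proof.
move=> a0 e; have : a *: (x - y) = 0 by rewrite scalerBr e subrr.
case/torsionfree => [/eqP|/eqP]; first by rewrite (negPf a0).
by rewrite subr_eq0 => /eqP.
Qed.

(** A spanning family of least size is free: in a relation, dividing by the
    coefficient that divides all others expresses one member through the rest. *)
Lemma free_basis (l : seq Q) : exists (s : nat) (y : 'I_s -> Q),
  [/\ forall x, lspan l x -> exists c : 'rV[V]_s, x = \sum_i c 0 i *: y i,
      forall i, lspan l (y i) &
      forall c : 'rV[V]_s, \sum_i c 0 i *: y i = 0 -> c = 0].
Proof.
have [s] : exists s, exists y : 'I_s -> Q,
    (forall x, lspan l x -> exists c : 'rV[V]_s, x = \sum_i c 0 i *: y i) /\
    (forall i, lspan l (y i)).
  exists (size l), (fun i => l`_i); split=> [x /lspan_nth[c ->]|i].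
    by exists (\row_i c i); apply: eq_bigr => i _; rewrite mxE.
  by apply: mem_lspan; rewrite mem_nth.
elim: s => [|s IHs] [y [hg hy]].
  by exists 0%N, y; split=> // c _; apply/rowP => -[].
case: (pselect (forall c : 'rV[V]_s.+1, \sum_i c 0 i *: y i = 0 -> c = 0)) => [fr|].
  by exists s.+1, y; split.
move/existsNP => [c /not_implyP[c0 /eqP cn0]].
have [|b] := @seq_gcd [seq c 0 i | i <- enum 'I_s.+1].
  by rewrite -size_eq0 size_map size_enum_ord.
case/mapP=> k _ -> {b} hk.
have hk' i : exists q, c 0 i = c 0 k * q by apply: hk; apply: map_f; rewrite mem_enum.
have [q hq] := @choice _ _ (fun i q => c 0 i = c 0 k * q) hk'.
have ck0 : c 0 k != 0.
  apply: contra cn0 => /eqP ck; apply/eqP/rowP => i.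
  by rewrite mxE hq ck mul0r.
(* [c 0 k] divides the other coefficients and can be cancelled. *)
have yk : y k = \sum_i (- q (lift k i)) *: y (lift k i).
  apply: (@scale_inj (c 0 k)) => //; move: c0; rewrite (bigD1_ord k) //=.
  move/eqP; rewrite addr_eq0 => /eqP->; rewrite scaler_sumr -sumrN.
  by apply: eq_bigr => i _; rewrite hq scalerA mulrN scaleNr.
apply: IHs; exists (fun i => y (lift k i)); split=> // x /hg[d ->].
exists (\row_i (d 0 (lift k i) - d 0 k * q (lift k i))).
rewrite (bigD1_ord k) //= yk scaler_sumr -big_split /=.
apply: eq_bigr => i _; rewrite mxE scalerA -scalerDl; congr (_ *: _).
by rewrite mulrN addrC.
Qed.
End Modules.

(** [C] is an initial segment of the nonnegative values of [V], without largest
    element: [C b] reads as the value of [b] lying in the segment. *)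
Section Lattice.
Variables (Z : lmodType V) (s : nat) (C : V -> Prop).
Hypotheses (C0 : ~ C 0) (C1 : C 1).
Hypothesis C_dvd : forall a b, C (a * b) -> C a.
Hypothesis C_nomax : forall b, C b -> exists2 t, t \in m & C (b * t).
Local Notation Q := (Z * 'rV[V]_s)%type.

Definition vdvd (b : V) (v : 'rV[V]_s) : Prop := exists v', v = b *: v'.

Lemma vdvd_submod b : submodP (vdvd b).
Proof.
split=> [|c _ _ [v1 ->] [v2 ->]]; first by exists 0; rewrite scaler0.
by exists (c *: v1 + v2); rewrite scalerDr !scalerA mulrC.
Qed.

Lemma vdvd_trans a b v : vdvd (a * b) v -> vdvd a v.
Proof. by case=> v' ->; exists (b *: v'); rewrite scalerA. Qed.

(** What lies beyond the segment is a strict multiple of what lies in it. *)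
Lemma cut_dvd (a b : V) : C b -> ~ C a -> exists2 t, t \in m & a = b * t.
Proof.
move=> Cb Ca; have [[c e]|//] := dvd_max b a.
by case: Ca; apply: (@C_dvd _ c); rewrite -e.
Qed.

Lemma entry_gcd (l : seq Q) :
  exists2 b : V, {in l, forall p, vdvd b p.2} &
    b = 0 \/ exists2 p, p \in l & exists j, b = (p.2 : 'rV[V]_s) 0 j.
Proof.
pose ent (p : Q) (j : 'I_s) : V := (p.2 : 'rV[V]_s) 0 j.
pose E := [seq ent p j | p <- l, j <- enum 'I_s].
case: (eqVneq E [::]) => [E0|/seq_gcd[b Eb hb]].
  exists 0; last by left.
  move=> p lp; exists 0; rewrite scale0r; apply/rowP => j.
  have : ent p j \in E by apply: allpairs_f; rewrite ?mem_enum.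
  by rewrite E0.
exists b; last first.
  by right; have /allpairsP[[p j] /= [lp _ ->]] := Eb; exists p => //; exists j.
move=> p lp; have h j : exists c, ent p j = b * c.
  by apply: hb; apply: allpairs_f; rewrite ?mem_enum.
have [c hc] := choice h; exists (\row_j c j).
by apply/rowP => j; rewrite !mxE; exact: hc.
Qed.

(** Elementary divisors.  A pair in [lspan l] is an element with the coordinates
    of its image under a linear map.  Were [l] a Smith basis, the image of its
    i-th member would be [b_i] times a primitive vector; for [b] larger than
    each [b_i] in [C], the elements with image divisible by [b] are spanned by
    the members with [b_i] outside [C] and by the multiples by [b / b_i], which
    is in [m], of the others.  Induction on the size of [l] gives this without
    constructing the basis: a pivot entry [a] dividing all entries is used to
    clear its column. *)
Lemma divisor_lattice (l : seq Q) : exists2 b0 : V, C b0 &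
  forall b b1, C b -> b = b0 * b1 -> exists G : seq Q,
    {in G, forall g, lspan l g /\ vdvd b g.2 /\
       ((exists2 b', ~ C b' & vdvd b' g.2) \/
        (exists t g', t \in m /\ lspan l g' /\ g = t *: g'))} /\
    forall q, lspan l q -> vdvd b q.2 -> lspan G q.
Proof.
have [r] := ubnP (size l); elim: r l => // r IHr l.
rewrite ltnS => sl; have [a la ha] := entry_gcd l.
have hspan q : lspan l q -> vdvd a q.2.
  apply: (@lspan_sub _ _ l (fun q : Q => vdvd a q.2)) => //.
  split; first by case: (vdvd_submod a).
  by move=> v x y; case: (vdvd_submod a) => _; apply.
case: (pselect (C a)) => Ca; last first.
  exists 1 => // b _ Cb _; exists l; split=> [g lg|q //].
  have [t _ at_] := cut_dvd Cb Ca.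
  split; first exact: mem_lspan.
  split; first by apply: (@vdvd_trans b t); rewrite -at_; exact: la.
  by left; exists a => //; exact: la.
case: ha => [a0|[p lp [j aj]]]; first by case: C0; rewrite -a0.
have a0 : a != 0 by apply/eqP => a0; apply: C0; rewrite -a0.
have hc (q : Q) : exists c, lspan l q -> (q.2 : 'rV[V]_s) 0 j = a * c.
  case: (pselect (lspan l q)) => [/hspan[v' e]|n]; last by exists 0.
  by exists (v' 0 j) => _; rewrite e mxE.
have [c {}hc] := choice hc.
pose red q := q - c q *: p.
pose l1 := [seq red q | q <- rem p l].
have sl1 : (size l1 < r)%N.
  rewrite size_map size_rem //; apply: leq_trans sl.
  by rewrite ltn_predL; case: (l) lp.
have [b0 Cb0 hb0] := IHr _ sl1.
have l1j (q0 : Q) : lspan l1 q0 -> (q0.2 : 'rV[V]_s) 0 j = 0.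
  apply: (@lspan_sub _ _ _ (fun q : Q => (q.2 : 'rV[V]_s) 0 j = 0)).
    by split=> [|v x y ex ey]; rewrite /= !mxE // ex ey mulr0 addr0.
  move=> _ /mapP[q /mem_rem lq ->]; rewrite /red /= !mxE -aj.
  by have := hc q (mem_lspan lq) => /= ->; rewrite mulrC subrr.
have l1l (q0 : Q) : lspan l1 q0 -> lspan l q0.
  apply: lspan_sub; first exact: lspan_submod.
  move=> _ /mapP[q' /mem_rem lq ->]; apply: (submodB (lspan_submod l)).
    exact: mem_lspan.
  by apply: (submodZ _ (lspan_submod l)); exact: mem_lspan.
have dec q0 : lspan l q0 -> exists t q', lspan l1 q' /\ q0 = t *: p + q'.
  apply: (@lspan_sub _ _ _ (fun q => exists t q', lspan l1 q' /\ q = t *: p + q')).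
    split.
      by exists 0, 0; rewrite scale0r addr0; split=> //; case: (lspan_submod l1).
    move=> v _ _ [t1 [q1 [h1 ->]]] [t2 [q2 [h2 ->]]].
    exists (v * t1 + t2), (v *: q1 + q2); split.
      by case: (lspan_submod l1) => _; apply.
    by rewrite scalerDr scalerDl scalerA addrACA.
  move=> q lq; case: (eqVneq q p) => [->|qp].
    by exists 1, 0; rewrite scale1r addr0; split=> //; case: (lspan_submod l1).
  exists (c q), (red q); split; last by rewrite addrC subrK.
  apply: mem_lspan; apply: map_f.
  have := perm_to_rem lp => /perm_mem/(_ q).
  by rewrite lq inE (negPf qp).
have [t mt Cat] := C_nomax Ca.
(* Past [b2], the induction hypothesis applies and [a] divides strictly. *)
have [b2 Cb2 [[d0 hd0] [d1 hd1]]] : exists2 b2, C b2 &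
    (exists d, b2 = b0 * d) /\ exists d, b2 = a * t * d.
  have [e|e] := dvd_total b0 (a * t).
    by exists b0 => //; split=> //; exists 1; rewrite mulr1.
  by exists (a * t) => //; split=> //; exists 1; rewrite mulr1.
exists b2 => // b b1 Cb eb.
have [|G1 [hG1 hG1']] := hb0 b (d0 * b1) Cb; first by rewrite eb hd0 mulrA.
have [tb mtb etb] : exists2 tb, tb \in m & b = a * tb.
  by exists (t * d1 * b1); rewrite ?maxMr // eb hd1 !mulrA.
exists (tb *: p :: G1); split.
  move=> g; rewrite inE => /orP[/eqP->|/hG1[h1 [h2 h3]]].
    split; first by apply: (submodZ _ (lspan_submod l)); exact: mem_lspan.
    split.
      by have [v' e] := la p lp; exists v'; rewrite /= e scalerA mulrC -etb.
    by right; exists tb, p; split=> //; split=> //; exact: mem_lspan.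
  split; first exact: l1l.
  split=> //; case: h3 => [|[t' [g' [? [? ?]]]]]; [by left | right].
  by exists t', g'; split=> //; split=> //; exact: l1l.
move=> q /dec[t' [q' [hq' ->]]] [v' e].
have tj : t' * a = b * v' 0 j.
  move/rowP/(_ j): e; rewrite /= !mxE (l1j _ hq') addr0 -aj => ->.
  by [].
have et' : t' = tb * v' 0 j.
  apply: (mulfI a0); rewrite mulrC tj etb; ring.
have sp := lspan_submod (tb *: p :: G1).
apply: (submodD sp).
  rewrite et' mulrC -scalerA; apply: (submodZ _ sp).
  by apply: mem_lspan; rewrite mem_head.
have : lspan G1 q'.
  apply: hG1' => //.
  have -> : q'.2 = (t' *: p + q').2 - t' *: p.2 by rewrite /= addrC addKr.
  rewrite e; apply: (submodB (vdvd_submod b)).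
    by exists v'.
  have [vp ->] := la p lp.
  by exists (v' 0 j *: vp); rewrite et' !scalerA etb; congr (_ *: _); ring.
apply: lspan_sub => // g G1g; apply: mem_lspan; by rewrite inE G1g orbT.
Qed.
End Lattice.
End ValuationRing.

(** * Filtrations by degree and the Hilbert basis theorem *)

(** Homogeneous elements of the Rees ring of the filtration are handled as
    elements of [W] together with a degree. *)
Section Filtration.
Variables (V : idomainType) (m : {pred V}).
Hypotheses (V_val : valuation_ring V) (V_max : maximal_ideal m).
Variable W : comAlgType V.
Implicit Types (S J : nat -> W -> Prop).

Record filtration S : Prop := Filtration {
  filt_submod : forall d, submodP (S d);
  filt1 : S 0%N 1;
  filtM : forall d e x y, S d x -> S e y -> S (d + e)%N (x * y);
  filt_le : forall d e x, (d <= e)%N -> S d x -> S e x }.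

Definition fg_pieces S := forall d,
  exists2 l : seq W, {in l, forall y, S d y} & forall x, S d x -> lspan l x.

Definition max_mul S d (z : W) : Prop :=
  exists mu s, [/\ mu \in m, S d s & z = mu *: s].

(** Homogeneous ideals of the Rees ring of [S]. *)
Record graded_ideal S J : Prop := GradedIdeal {
  gideal_sub : forall d z, J d z -> S d z;
  gideal0 : forall d, J d 0;
  gidealD : forall d x y, J d x -> J d y -> J d (x + y);
  gidealM : forall d e s y, S e s -> J d y -> J (e + d)%N (s * y) }.

Definition above S (G : seq (nat * W)) J' : Prop :=
  [/\ graded_ideal S J', forall d z, max_mul S d z -> J' d z &
      {in G, forall g, J' g.1 g.2}].

(** The property [Phi] of graded ideals containing the multiples of [m] holds
    as soon as finitely many suitable elements of [J] have been added.  Finite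
    generation modulo [m] is the case where [Phi] says that [J] is contained in
    the ideal; stating it without coefficients makes finite sets of generators
    combine by [forced_and] and [forced_all]. *)
Definition forced S J (Phi : (nat -> W -> Prop) -> Prop) : Prop :=
  exists2 G : seq (nat * W), {in G, forall g, J g.1 g.2} &
    forall J', above S G J' -> Phi J'.

Definition noetherian S : Prop := forall J, graded_ideal S J ->
  forced S J (fun J' => forall d z, J d z -> J' d z).

Lemma forced_and S J Phi Psi : forced S J Phi -> forced S J Psi ->
  forced S J (fun J' => Phi J' /\ Psi J').
Proof.
move=> [G1 h1 k1] [G2 h2 k2]; exists (G1 ++ G2).
  by move=> g; rewrite mem_cat => /orP[/h1|/h2].
move=> J' [gJ mJ GJ]; split; [apply: k1 | apply: k2]; split=> // g Gg;
  by apply: GJ; rewrite mem_cat Gg ?orbT.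
Qed.

Lemma forced_all S J (A : eqType) (l : seq A) Phi :
  {in l, forall a, forced S J (Phi a)} ->
  forced S J (fun J' => {in l, forall a, Phi a J'}).
Proof.
elim: l => [|a l IHl] h; first by exists [::].
have [|G hG kG] := forced_and (h a (mem_head _ _)) (IHl _).
  by move=> b lb; apply: h; rewrite inE lb orbT.
exists G => // J' /kG[Pa Pl] b; rewrite inE => /orP[/eqP->//|].
exact: Pl.
Qed.

Lemma forced_imp S J Phi (Psi : _ -> Prop) : forced S J Phi ->
  (forall J', above S [::] J' -> Phi J' -> Psi J') -> forced S J Psi.
Proof.
move=> [G hG kG] h; exists G => // J' aJ; apply: h; last exact: kG.
by case: aJ.
Qed.

Section WithFiltration.
Variable S : nat -> W -> Prop.
Hypothesis fS : filtration S.

Lemma gidealZ J d v x : graded_ideal S J -> J d x -> J d (v *: x).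
Proof.
move=> gJ Jx; rewrite -[x]mul1r scalerAl -[d]add0n; apply: (gidealM gJ) => //.
by apply: (submodZ _ (filt_submod fS 0)); exact: filt1.
Qed.

Lemma gidealB J d x y : graded_ideal S J -> J d x -> J d y -> J d (x - y).
Proof.
move=> gJ Jx Jy; apply: (gidealD gJ) => //.
by rewrite -scaleN1r; exact: gidealZ.
Qed.

Lemma gidealI J J' : graded_ideal S J -> graded_ideal S J' ->
  graded_ideal S (fun d z => J d z /\ J' d z).
Proof.
move=> [a1 b1 c1 d1] [a2 b2 c2 d2]; split=> //; first by move=> d z [/a1].
  by move=> d x y [? ?] [? ?]; split; auto.
by move=> d e s y ? [? ?]; split; auto.
Qed.

Lemma max_mul0 d : max_mul S d 0.
Proof.
exists 0, 0; split; rewrite ?scaler0 ?max0 //.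
by case: (filt_submod fS d).
Qed.

Lemma max_mulD d x y : max_mul S d x -> max_mul S d y -> max_mul S d (x + y).
Proof.
move=> [u [s [mu Ss ->]]] [v [t [mv St ->]]].
have [w mw [[a ->] [b ->]]] := max_gcd V_val mu mv.
exists w, (a *: s + b *: t); split=> //.
  by apply: (submodD (filt_submod fS d)); apply: (submodZ _ (filt_submod fS d)).
by rewrite scalerDr !scalerA.
Qed.

Lemma max_mulM d e s y : S e s -> max_mul S d y -> max_mul S (e + d)%N (s * y).
Proof.
move=> Ss [u [t [mu St ->]]]; exists u, (s * t); split=> //.
  exact: (filtM fS).
by rewrite scalerAr.
Qed.

Lemma max_mul_sub d x : max_mul S d x -> S d x.
Proof. by move=> [u [t [mu St ->]]]; exact: (submodZ _ (filt_submod fS d)). Qed.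

Lemma max_mulZ d v x : max_mul S d x -> max_mul S d (v *: x).
Proof.
move=> [u [t [mu St ->]]]; exists (v * u), t; split=> //; first exact: maxM.
by rewrite scalerA.
Qed.

Definition plus_max J d z : Prop :=
  exists x y, [/\ J d x, max_mul S d y & z = x + y].

Lemma plus_max_gideal J : graded_ideal S J -> graded_ideal S (plus_max J).
Proof.
move=> gJ; split.
- move=> d _ [x [y [Jx my ->]]]; apply: (submodD (filt_submod fS d)).
    exact: (gideal_sub gJ).
  exact: max_mul_sub.
- by move=> d; exists 0, 0; split; [exact: gideal0 gJ _ | exact: max_mul0 | rewrite addr0].
- move=> d _ _ [x1 [y1 [J1 m1 ->]]] [x2 [y2 [J2 m2 ->]]].
  exists (x1 + x2), (y1 + y2); split; last by rewrite addrACA.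
    exact: (gidealD gJ).
  exact: max_mulD.
- move=> d e s _ Ss [x [y [Jx my ->]]].
  exists (s * x), (s * y); split; last by rewrite mulrDr.
    exact: (gidealM gJ).
  exact: max_mulM.
Qed.

(** A generator of [J + m S] may be replaced by its component in [J]. *)
Lemma noetherian_plus_max :
  (forall J, graded_ideal S J -> (forall d z, max_mul S d z -> J d z) ->
     forced S J (fun J' => forall d z, J d z -> J' d z)) ->
  noetherian S.
Proof.
move=> h J gJ.
have [|G hG kG] := h _ (plus_max_gideal gJ).
  move=> d z mz; exists 0, z; split; rewrite ?add0r //; exact: gideal0 gJ _.
suff : forced S J (fun J' => {in G, forall g, J' g.1 g.2}).
  move/forced_imp; apply => J' [gJ' mJ' _] GJ' d z Jz; apply: (kG J').
    by split.
  by exists z, 0; split; rewrite ?addr0 //; exact: max_mul0.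
apply: forced_all => -[d z] /hG /= [x [y [Jx my ->]]].
exists [:: (d, x)] => [g|J' [gJ' mJ' GJ']]; first by rewrite inE => /eqP->.
apply: (gidealD gJ'); last exact: mJ'.
by apply: (GJ' (d, x)); rewrite mem_head.
Qed.

End WithFiltration.

(** Adjoining [a] in degree 1. *)
Section Adjoin.
Variables (S : nat -> W -> Prop) (a : W).
Hypothesis fS : filtration S.

(** Polynomials in [a] of degree less than [i], homogeneous of total degree [d].
    Only meant for [i <= d.+1], so that [d - k] is not truncated. *)
Definition poly_lt i d z : Prop := exists s : nat -> W,
  (forall k, (k < i)%N -> S (d - k)%N (s k)) /\ z = \sum_(k < i) a ^+ k * s k.

Definition adjoin d z : Prop := poly_lt d.+1 d z.

Local Notation T := poly_lt.

Lemma poly_lt_submod i d : submodP (T i d).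
Proof.
split.
  exists (fun=> 0); split=> [k _|]; first by case: (filt_submod fS (d - k)).
  by rewrite big1 // => k _; rewrite mulr0.
move=> v _ _ [s1 [h1 ->]] [s2 [h2 ->]]; exists (fun k => v *: s1 k + s2 k); split.
  by move=> k ki; case: (filt_submod fS (d - k)) => _; apply; auto.
rewrite scaler_sumr -big_split; apply: eq_bigr => k _ /=.
by rewrite mulrDr scalerAr.
Qed.

Lemma poly_lt0 d z : T 0 d z -> z = 0.
Proof. by case=> s [_ ->]; rewrite big_ord0. Qed.

Lemma poly_ltS i d z : T i.+1 d z ->
  exists c r, [/\ S (d - i)%N c, T i d r & z = a ^+ i * c + r].
Proof.
case=> s [hs ->]; rewrite big_ord_recr /= addrC.
exists (s i), (\sum_(k < i) a ^+ k * s k); split=> //; first exact: hs.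
by exists s; split=> // k ki; apply: hs; exact: ltnW.
Qed.

Lemma poly_lt_lead i d c r : S (d - i)%N c -> T i d r -> T i.+1 d (a ^+ i * c + r).
Proof.
move=> Sc [s [hs ->]]; exists (fun k => if (k < i)%N then s k else c); split.
  move=> k; rewrite ltnS leq_eqVlt => /orP[/eqP->|ki]; first by rewrite ltnn.
  by rewrite ki; exact: hs.
rewrite big_ord_recr /= ltnn addrC; congr (_ + _).
by apply: eq_bigr => k _; rewrite ltn_ord.
Qed.

Lemma poly_lt_le i j d z : (i <= j)%N -> T i d z -> T j d z.
Proof.
elim: j => [|j IHj]; first by rewrite leqn0 => /eqP->.
rewrite leq_eqVlt => /orP[/eqP->//|]; rewrite ltnS => /IHj h /h Tz.
rewrite -[z]add0r -(mulr0 (a ^+ j)); apply: poly_lt_lead => //.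
by case: (filt_submod fS (d - j)).
Qed.

Lemma poly_lt_led i d e z : (d <= e)%N -> T i d z -> T i e z.
Proof.
move=> de [s [hs ->]]; exists s; split=> // k /hs; apply: (filt_le fS); lia.
Qed.

Lemma poly_lt_mull i d e c z : (i <= d.+1)%N -> S e c -> T i d z -> T i (e + d) (c * z).
Proof.
move=> id Sc [s [hs ->]]; exists (fun k => c * s k); split.
  move=> k ki; have -> : (e + d - k = e + (d - k))%N by lia.
  by apply: (filtM fS) => //; exact: hs.
by rewrite mulr_sumr; apply: eq_bigr => k _; rewrite mulrCA.
Qed.

Lemma poly_lt_mulX i d z : T i d z -> T i.+1 d.+1 (a * z).
Proof.
move=> [s [hs ->]]; exists (fun k => if k is k'.+1 then s k' else 0); split.
  case=> [|k] ki; first by case: (filt_submod fS (d.+1 - 0)).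
  by rewrite subSS; exact: hs.
rewrite big_ord_recl /= mulr0 add0r mulr_sumr.
by apply: eq_bigr => k _; rewrite exprS mulrA.
Qed.

Lemma poly_lt_mulXn i d z k : T i d z -> T (k + i) (k + d) (a ^+ k * z).
Proof.
move=> Tz; elim: k => [|k IHk]; first by rewrite expr0 mul1r.
by rewrite exprS -mulrA !addSn; exact: poly_lt_mulX.
Qed.

Lemma sub_adjoin d x : S d x -> adjoin d x.
Proof.
move=> Sx; apply: (@poly_lt_le 1) => //.
have -> : x = a ^+ 0 * x + 0 by rewrite expr0 mul1r addr0.
apply: poly_lt_lead; first by rewrite subn0.
by exists (fun=> 0); rewrite big_ord0; split.
Qed.

Lemma mem_adjoin : adjoin 1 a.
Proof.
rewrite -[a]mulr1; apply: poly_lt_mulX; apply: sub_adjoin; exact: filt1.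
Qed.

Lemma adjoin_filtration : filtration adjoin.
Proof.
split=> [d||d e x y|d e x de].
- exact: poly_lt_submod.
- by apply: sub_adjoin; exact: filt1.
- move=> [s [hs ->]] Ty; rewrite mulr_suml.
  have sP := poly_lt_submod (d + e).+1 (d + e).
  rewrite big_seq; elim/big_ind: _ => [|? ?|k _]; first by case: sP.
    exact: (submodD sP).
  rewrite -mulrA mulrCA.
  have -> : (d + e = (d - k) + (k + e))%N by have := ltn_ord k; lia.
  apply: (@poly_lt_le (k + e.+1)); first by lia.
  apply: poly_lt_mull; first by lia.
    by apply: hs.
  exact: poly_lt_mulXn.
- by move=> Tx; apply: (@poly_lt_le d.+1) => //; exact: (poly_lt_led de).
Qed.

Lemma adjoin_fg : fg_pieces S -> fg_pieces adjoin.
Proof.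
move=> fgS d; rewrite /adjoin; elim: d.+1 => [|i [l hl kl]].
  by exists [::] => // x /poly_lt0 ->; case: (lspan_submod (Q := W) [::]).
have [l' hl' kl'] := fgS (d - i)%N.
exists (l ++ [seq a ^+ i * y | y <- l']).
  move=> y; rewrite mem_cat => /orP[/hl|/mapP[c /hl' Sc ->]].
    exact: poly_lt_le.
  rewrite -[_ * _]addr0; apply: poly_lt_lead => //.
  by case: (poly_lt_submod i d).
move=> _ /poly_ltS[c [r [Sc Tr ->]]].
have sP := lspan_submod (l ++ [seq a ^+ i * y | y <- l']).
apply: (submodD sP).
  apply: (lspan_sub (P := fun c => lspan (l ++ [seq a ^+ i * y | y <- l']) (a ^+ i * c)) _ _ (kl' _ Sc)).
    split; first by rewrite mulr0; case: sP.
    by move=> v x y hx hy; rewrite mulrDr -scalerAr; case: sP => _; apply.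
  by move=> y ly; apply: mem_lspan; rewrite mem_cat map_f ?orbT.
apply: (lspan_sub sP _ (kl _ Tr)) => y ly; apply: mem_lspan.
by rewrite mem_cat ly.
Qed.

(** The ideal of leading coefficients in Hilbert's proof.  The element [a] may be
    algebraic over [S], so this refers to expressions and not to a well-defined
    leading coefficient. *)
Definition lead J i e c : Prop :=
  S e c /\ exists2 r, T i (e + i) r & J (e + i)%N (a ^+ i * c + r).

Lemma lead_gideal J i : graded_ideal adjoin J -> graded_ideal S (lead J i).
Proof.
move=> gJ; split.
- by move=> d z [].
- move=> d; split; first by case: (filt_submod fS d).
  exists 0; first by case: (poly_lt_submod i (d + i)).
  by rewrite mulr0 addr0; exact: gideal0 gJ _.
- move=> d x y [Sx [r Tr Jr]] [Sy [t Tt Jt]]; split.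
    exact: (submodD (filt_submod fS d)).
  exists (r + t); first exact: (submodD (poly_lt_submod i (d + i))).
  by rewrite mulrDr addrACA; exact: (gidealD gJ).
- move=> d e s y Ss [Sy [r Tr Jr]]; split; first exact: (filtM fS).
  exists (s * r); rewrite -addnA.
    by apply: poly_lt_mull => //; lia.
  by rewrite mulrCA -mulrDr; apply: (gidealM gJ) => //; exact: sub_adjoin.
Qed.

Lemma lead_max J i : graded_ideal adjoin J ->
  (forall d z, max_mul adjoin d z -> J d z) ->
  forall d z, max_mul S d z -> lead J i d z.
Proof.
move=> gJ mJ d z mz; split; first exact: max_mul_sub mz.
exists 0; first by case: (poly_lt_submod i (d + i)).
rewrite addr0; apply: mJ; case: mz => mu [s [mmu Ss ->]].
exists mu, (a ^+ i * s); split=> //; last by rewrite scalerAr.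
rewrite -[X in adjoin X]addnC; apply: (@poly_lt_le (i + d.+1)); first by lia.
by apply: poly_lt_mulXn; exact: sub_adjoin.
Qed.

(** Multiply by [a]. *)
Lemma leadS J i e c : graded_ideal adjoin J -> lead J i e c -> lead J i.+1 e c.
Proof.
move=> gJ [Sc [r Tr Jr]]; split=> //; exists (a * r); rewrite addnS.
  exact: poly_lt_mulX.
rewrite exprS -mulrA -mulrDr -add1n; apply: (gidealM gJ) => //; exact: mem_adjoin.
Qed.

Lemma lead_le J i j e c : graded_ideal adjoin J -> (i <= j)%N ->
  lead J i e c -> lead J j e c.
Proof.
move=> gJ; elim: j => [|j IHj]; first by rewrite leqn0 => /eqP->.
by rewrite leq_eqVlt => /orP[/eqP->//|]; rewrite ltnS => /IHj h /h; exact: leadS.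
Qed.

Lemma lead_forced J i (G : seq (nat * W)) : graded_ideal adjoin J ->
  {in G, forall g, lead J i g.1 g.2} ->
  forced adjoin J (fun J' =>
    {in G, forall g, lead (fun d z => J d z /\ J' d z) i g.1 g.2}).
Proof.
move=> gJ hG; apply: forced_all => -[e c] /hG /= [Sc [r Tr Jr]].
exists [:: ((e + i)%N, a ^+ i * c + r)] => [g|J' [_ _ GJ']].
  by rewrite inE => /eqP->.
split=> //; exists r => //; split=> //.
by apply: (GJ' ((e + i)%N, a ^+ i * c + r)); rewrite mem_head.
Qed.

(** Hilbert's basis theorem.  The leading ideals [lead J i] increase with [i];
    generators of their union occur below some [N], and the ideals with
    [i <= N] need finitely many generators each.  An ideal [J'] containing lifts
    of all these satisfies [lead J i] = [lead (J and J') i] for every [i], so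
    that subtracting an element of [J] and [J'] lowers the degree in [a]. *)
Theorem adjoin_noetherian : noetherian S -> noetherian adjoin.
Proof.
move=> nS; apply: (noetherian_plus_max adjoin_filtration) => J gJ mJ.
pose L e c := exists i, lead J i e c.
have gL : graded_ideal S L.
  split.
  - by move=> d z [i []].
  - by move=> d; exists 0%N; exact: gideal0 (lead_gideal 0 gJ) _.
  - move=> d x y [i hi] [j hj]; exists (maxn i j).
    apply: (gidealD (lead_gideal _ gJ)).
      by apply: lead_le hi => //; exact: leq_maxl.
    by apply: lead_le hj => //; exact: leq_maxr.
  - by move=> d e s y Ss [i hi]; exists i; exact: (gidealM (lead_gideal _ gJ)).
have [G hG kG] := nS _ gL.
have [N hN] : exists N, {in G, forall g, lead J N g.1 g.2}.
  elim: (G) hG => [|g G' IHG] hG'; first by exists 0%N.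
  have [|N hN] := IHG; first by move=> g' Gg; apply: hG'; rewrite inE Gg orbT.
  have [i hi] := hG' g (mem_head _ _).
  exists (maxn i N) => g'; rewrite inE => /orP[/eqP->|/hN].
    by apply: lead_le hi => //; exact: leq_maxl.
  by apply: lead_le => //; exact: leq_maxr.
have hF : forced adjoin J (fun J' => {in iota 0 N.+1, forall i, forall e c,
    lead J i e c -> lead (fun d z => J d z /\ J' d z) i e c}).
  apply: forced_all => i _.
  have [Gi hGi kGi] := nS _ (lead_gideal i gJ).
  apply: (forced_imp (lead_forced gJ hGi)) => J' [gJ' mJ' _] GJ'.
  have gJJ := gidealI gJ gJ'.
  apply: kGi; split=> //; first exact: lead_gideal.
  by apply: lead_max => // d z mz; split; [exact: mJ | exact: mJ'].
apply: (forced_imp (forced_and hF (lead_forced gJ hN))) => J' [gJ' mJ' _] [hi hL].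
have gJJ := gidealI gJ gJ'.
have mJJ d z : max_mul adjoin d z -> J d z /\ J' d z.
  by move=> mz; split; [exact: mJ | exact: mJ'].
have leadE i e c : lead J i e c -> lead (fun d z => J d z /\ J' d z) i e c.
  case: (leqP i N) => iN; first by apply: hi; rewrite mem_iota.
  move=> hc; have : L e c by exists i.
  apply: (kG (lead _ i)); split=> //; first exact: lead_gideal.
    exact: lead_max.
  by move=> g /hL; apply: lead_le => //; exact: ltnW.
(* Induction on the degree in [a]. *)
suff key i d z : (i <= d.+1)%N -> T i d z -> J d z -> J' d z.
  move=> d z Jz; apply: (key d.+1) => //; exact: (gideal_sub gJ).
elim: i z => [|i IHi] z id.
  by move/poly_lt0=> -> _; exact: gideal0 gJ' _.
case/poly_ltS=> c [r [Sc Tr ez]] Jz.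
have ed : (d - i + i = d)%N by lia.
have /leadE : lead J i (d - i) c by split=> //; rewrite ed; exists r; rewrite -?ez.
case=> _ [r' Tr' []]; rewrite ed in Tr' *; move=> Jr' J'r'.
have -> : z = (a ^+ i * c + r') + (r - r') by rewrite ez addrACA subrr addr0 addrC.
apply: (gidealD gJ') => //; apply: IHi; first exact: ltnW.
  exact: (submodB (poly_lt_submod i d)).
have -> : r - r' = z - (a ^+ i * c + r') by rewrite ez opprD addrACA subrr add0r.
exact: (gidealB adjoin_filtration gJ).
Qed.
End Adjoin.

Definition scalars (d : nat) (z : W) : Prop := exists v : V, z = v%:A.

Lemma scalars_filtration : filtration scalars.
Proof.
split=> [d||d e _ _ [u ->] [v ->]|d e x _ //].
- split; first by exists 0; rewrite scale0r.
  by move=> v _ _ [a ->] [b ->]; exists (v * a + b); rewrite scalerDl scalerA.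
- by exists 1; rewrite scale1r.
- by exists (u * v); rewrite -scalerAl mul1r scalerA.
Qed.

Lemma scalars_fg : fg_pieces scalars.
Proof.
move=> d; exists [:: 1].
  by move=> y; rewrite inE => /eqP->; exists 1; rewrite scale1r.
move=> _ [v ->]; apply: (submodZ _ (lspan_submod _)).
by apply: mem_lspan; rewrite mem_head.
Qed.

(** Modulo [m] a graded ideal of the polynomial ring over a field in the variable
    recording the degree: generated by the least degree where it contains 1. *)
Lemma scalars_noetherian : noetherian scalars.
Proof.
move=> J gJ.
case: (pselect (exists d, J d 1)) => [exJ|nJ]; last first.
  exists [::] => // J' [gJ' mJ' _] d z Jz.
  have [v ez] := gideal_sub gJ Jz.
  case mv: (v \in m).
    by apply: mJ'; exists v, 1; split=> //; exists 1; rewrite scale1r.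
  case: nJ; exists d; move/negbT: mv; rewrite (max_unit V_val V_max) negbK => Uv.
  have -> : 1 = v^-1 *: z by rewrite ez scalerA mulVr // scale1r.
  exact: (gidealZ scalars_filtration _ gJ).
have exJb : exists d, `[< J d 1 >] by case: exJ => d Jd; exists d; apply/asboolP.
case: (ex_minnP exJb) => d0 /asboolP Jd0 hmin.
exists [:: (d0, 1)] => [g|J' [gJ' mJ' GJ']]; first by rewrite inE => /eqP->.
have J'1 : J' d0 1 by apply: (GJ' (d0, 1)); rewrite mem_head.
move=> d z Jz; have [v ez] := gideal_sub gJ Jz.
case mv: (v \in m).
  by apply: mJ'; exists v, 1; split=> //; exists 1; rewrite scale1r.
have Jd : J d 1.
  move/negbT: mv; rewrite (max_unit V_val V_max) negbK => Uv.
  have -> : 1 = v^-1 *: z by rewrite ez scalerA mulVr // scale1r.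
  exact: (gidealZ scalars_filtration _ gJ).
have d0d : (d0 <= d)%N by apply: hmin; apply/asboolP.
rewrite -[z]mulr1 -(subnK d0d); apply: (gidealM gJ') => //.
by exists v.
Qed.

(** The filtration by degree in [gens]; [D] keeps track of the subalgebra in
    which it lives. *)
Lemma generated_filtration (gens : seq W) (D : W -> Prop) :
  D 1 -> (forall v x y, D x -> D y -> D (v *: x + y)) ->
  (forall x y, D x -> D y -> D (x * y)) -> {in gens, forall a, D a} ->
  exists S, [/\ filtration S, fg_pieces S, noetherian S,
    {in gens, forall a, S 1%N a} & forall d z, S d z -> D z].
Proof.
move=> D1 DZ DM.
have D0 : D 0 by rewrite -(subrr 1) addrC -scaleN1r; exact: DZ.
elim: gens => [|a l IHl] hD.
  exists scalars; split=> //.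
  - exact: scalars_filtration.
  - exact: scalars_fg.
  - exact: scalars_noetherian.
  - by move=> d _ [v ->]; rewrite -[_%:A]addr0; exact: DZ.
have [|S [fS fgS nS hS hSD]] := IHl; first by move=> b lb; apply: hD; rewrite inE lb orbT.
have Da : D a by apply: hD; rewrite mem_head.
exists (adjoin S a); split.
- exact: adjoin_filtration.
- exact: adjoin_fg.
- exact: adjoin_noetherian.
- move=> b; rewrite inE => /orP[/eqP->|/hS]; first exact: mem_adjoin.
  exact: sub_adjoin.
- move=> d _ [s [hs ->]]; elim: d.+1 hs => [|i IHi] hs; first by rewrite big_ord0.
  rewrite big_ord_recr /= addrC -[_ * _]scale1r; apply: (DZ).
    apply: (DM); last by apply: hSD (hs i _).
    by elim: i {IHi hs} => [|i IHi]; rewrite ?expr0 // exprS; exact: DM.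
  by apply: IHi => k ki; apply: hs; exact: ltnW.
Qed.
End Filtration.

(** * Nakayama's lemma and the existence of contents *)

Section Nakayama.
Variables (W : comUnitRingType) (n : {pred W}).
Hypothesis n_unit : forall x, (x \in n) = (x \isn't a GRing.unit).
Hypothesis nD : forall x y, x \in n -> y \in n -> x + y \in n.

Lemma nonunitM a x : x \in n -> a * x \in n.
Proof. by rewrite !n_unit unitrM negb_and orbC => ->. Qed.

Lemma nonunit0 : 0 \in n.
Proof. by rewrite n_unit unitr0. Qed.

Definition idealP (P : W -> Prop) : Prop :=
  [/\ P 0, forall x y, P x -> P y -> P (x + y) & forall a x, P x -> P (a * x)].

(** The product of the ideal [n] and of the ideal generated by [l]. *)
Definition nspan (l : seq W) (z : W) : Prop := forall P, idealP P ->
  (forall u y, u \in n -> y \in l -> P (u * y)) -> P z.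

Lemma nspan_ideal l : idealP (nspan l).
Proof.
split=> [P [] //|x y hx hy P iP hP|a x hx P iP hP]; case: (iP) => _ PD PM.
  by apply: (PD); [exact: hx | exact: hy].
by apply: (PM); exact: hx.
Qed.

Lemma nspan_cons y l z : nspan (y :: l) z ->
  exists u z', [/\ u \in n, nspan l z' & z = u * y + z'].
Proof.
have [N0 ND NM] := nspan_ideal l.
move/(_ (fun z => exists u z', [/\ u \in n, nspan l z' & z = u * y + z'])); apply.
  split.
  - by exists 0, 0; rewrite mul0r addr0 nonunit0.
  - move=> _ _ [u [z1 [nu h1 ->]]] [v [z2 [nv h2 ->]]].
    exists (u + v), (z1 + z2); rewrite mulrDl addrACA; split=> //; first exact: nD.
    exact: ND.
  - move=> a _ [u [z1 [nu h1 ->]]]; exists (a * u), (a * z1).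
    by rewrite mulrDr mulrA; split=> //; [exact: nonunitM | exact: NM].
move=> u x nu; rewrite inE => /orP[/eqP->|lx].
  by exists u, 0; rewrite addr0.
exists 0, (u * x); rewrite mul0r add0r nonunit0; split=> // P [_ _ PM] hP.
exact: hP.
Qed.

Lemma one_sub_unit u : u \in n -> 1 - u \is a GRing.unit.
Proof.
move=> nu; apply/negPn; rewrite -n_unit; apply/negP => n1u.
by have := nD n1u nu; rewrite subrK n_unit unitr1.
Qed.

(** Solving the first equation for [y], as [1 - u] is a unit, removes [y] from the
    generators. *)
Lemma nakayama l : {in l, forall z, nspan l z} -> {in l, forall z, z = 0}.
Proof.
elim: l => // y l IHl h.
have [N0 ND NM] := nspan_ideal l.
have [u [z' [nu h' ey]]] := nspan_cons (h y (mem_head _ _)).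
have Uu := one_sub_unit nu.
have hy : nspan l y.
  have -> : y = (1 - u)^-1 * z'.
    have ez : z' = (1 - u) * y by rewrite mulrBl mul1r {1}ey addrAC subrr add0r.
    by rewrite ez mulKr.
  exact: NM.
have hl : {in l, forall z, z = 0}.
  apply: IHl => z lz.
  have [|v [z2 [nv h2 ->]]] := @nspan_cons y l z.
    by apply: h; rewrite inE lz orbT.
  by apply: ND => //; exact: NM.
move=> z; rewrite inE => /orP[/eqP->|/hl //].
apply: (hy (fun y => y = 0)) => //.
  by split=> // [a b -> ->|a b ->]; rewrite ?addr0 ?mulr0.
by move=> v x _ /hl->; rewrite mulr0.
Qed.
End Nakayama.

Section Content.
Variables (V : idomainType) (m : {pred V}).
Hypotheses (V_val : valuation_ring V) (V_max : maximal_ideal m).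
Variables (W : comUnitAlgType V) (n : {pred W}).
Hypothesis torsionfree : forall (a : V) (x : W), a *: x = 0 -> a = 0 \/ x = 0.
Hypothesis n_unit : forall x, (x \in n) = (x \isn't a GRing.unit).
Hypothesis n_max : forall w, w \in n <-> exists mu w', mu \in m /\ w = mu *: w'.
Variable S : nat -> W -> Prop.
Hypotheses (fS : filtration S) (fgS : fg_pieces S) (nS : noetherian m S).
Hypothesis S_loc : forall d z, S d z -> z \in n ->
  exists e s, [/\ S e s, s \notin n & max_mul m S (e + d)%N (s * z)].

Local Notation scale_inj := (scale_inj torsionfree).
Local Notation mS := (max_mul m S).

(** [n] is closed under sums because [m] is and divisibility in [V] is total. *)
Lemma max_extD x y : x \in n -> y \in n -> x + y \in n.
Proof.
move=> /n_max[u [s [mu ->]]] /n_max[v [t [mv ->]]]; apply/n_max.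
have [w mw [[a ->] [b ->]]] := max_gcd V_val mu mv.
by exists w, (a *: s + b *: t); rewrite scalerDr !scalerA.
Qed.

Let SD d y z : S d y -> S d z -> S d (y + z).
Proof. exact: submodD (filt_submod fS d). Qed.

Let SZ d v y : S d y -> S d (v *: y).
Proof. exact: submodZ (filt_submod fS d). Qed.

Let Szero d : S d 0. Proof. by case: (filt_submod fS d). Qed.

Variables (h : nat) (x : W).
Hypotheses (Sx : S h x) (x0 : x != 0).

Let C (b : V) : Prop := exists w, x = b *: w.

Hypothesis no_content : forall b u, x = b *: u -> u \isn't a GRing.unit.

Let C0 : ~ C 0.
Proof. by case=> w; rewrite scale0r => /eqP; rewrite (negPf x0). Qed.

Let C1 : C 1. Proof. by exists x; rewrite scale1r. Qed.

Let C_dvd a b : C (a * b) -> C a.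
Proof. by case=> w ew; exists (b *: w); rewrite ew scalerA. Qed.

Let C_neq0 b : C b -> b != 0.
Proof. by move=> Cb; apply/eqP => b0; apply: C0; rewrite -b0. Qed.

Let C_nomax b : C b -> exists2 t, t \in m & C (b * t).
Proof.
case=> w ew; have : w \in n by rewrite n_unit; exact: no_content ew.
case/n_max=> t [w' [mt ew']]; exists t => //.
by exists w'; rewrite ew ew' scalerA.
Qed.

Let cut_dvd (a b : V) : C b -> ~ C a -> exists2 t, t \in m & a = b * t.
Proof. exact: (cut_dvd V_val V_max C_dvd). Qed.

(** As [C] is a segment, [F1] says that [x z] is divisible, inside the
    filtration, by more than [x] is in [W]; [F2] consists of quotients [x z / b]
    with [b] in [C].  Subtraction of degrees truncates, whence the clause
    forcing [z = 0] in [F2]. *)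
Let F1 d (z : W) : Prop := S d z /\ exists2 b, ~ C b &
  exists2 y, S (d + h)%N y & x * z = b *: y.

Let F2 d (y : W) : Prop := S d y /\ exists2 b, C b &
  exists z, [/\ S (d - h)%N z, (d < h)%N -> z = 0 & x * z = b *: y].

(** Otherwise [z] is a unit and [b] divides [x] in [W]. *)
Let F1_max d z : F1 d z -> z \in n.
Proof.
case=> Sz [b Cb [y Sy e]]; rewrite n_unit; apply/negP => Uz; apply: Cb.
by exists (y / z); rewrite scalerAl -e mulrK.
Qed.

(** [x / b] is a multiple of an element of [m], since [b] is not largest. *)
Let F2_max d y : F2 d y -> y \in n.
Proof.
case=> Sy [b Cb [z [Sz _ e]]]; apply/n_max.
have [t mt [w ew]] := C_nomax Cb; exists t, (w * z); split=> //.
apply: (scale_inj (C_neq0 Cb)).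
by rewrite -e ew -scalerAl scalerA.
Qed.

Let C_lub a b : C a -> C b -> exists2 c, C c & (exists d, c = a * d) /\ exists d, c = b * d.
Proof.
move=> Ca Cb; have [e|e] := dvd_total V_val a b.
  by exists a => //; split=> //; exists 1; rewrite mulr1.
by exists b => //; split=> //; exists 1; rewrite mulr1.
Qed.

Let F1_gideal : graded_ideal S F1.
Proof.
split.
- by move=> d z [].
- move=> d; split=> //; exists 0 => //; exists 0 => //; by rewrite mulr0 scaler0.
- move=> d y1 y2 [S1 [b1 C1' [z1 Sz1 e1]]] [S2 [b2 C2 [z2 Sz2 e2]]].
  split; first exact: SD.
  have [[c ec]|[c ec]] := dvd_total V_val b1 b2.
    exists b2 => //; exists (c *: z1 + z2); first by apply: SD => //; exact: SZ.
    by rewrite mulrDr e1 e2 ec scalerDr scalerA.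
  exists b1 => //; exists (z1 + c *: z2); first by apply: SD => //; exact: SZ.
  by rewrite mulrDr e1 e2 ec scalerDr scalerA.
- move=> d e s y Ss [Sy [b Cb [z Sz exy]]]; split; first exact: (filtM fS).
  exists b => //; exists (s * z); first by rewrite -addnA; exact: (filtM fS).
  by rewrite mulrCA exy scalerAr.
Qed.

Let F2_gideal : graded_ideal S F2.
Proof.
split.
- by move=> d z [].
- move=> d; split=> //; exists 1 => //; exists 0; by rewrite mulr0 scaler0.
- move=> d y1 y2 [S1 [b1 C1' [z1 [Sz1 h1 e1]]]] [S2 [b2 C2 [z2 [Sz2 h2 e2]]]].
  split; first exact: SD.
  have [b Cb [[d1 hd1] [d2 hd2]]] := C_lub C1' C2.
  exists b => //; exists (d1 *: z1 + d2 *: z2); split.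
  + by apply: SD; exact: SZ.
  + by move=> dh; rewrite h1 // h2 // !scaler0 addr0.
  + by rewrite mulrDr -!scalerAr e1 e2 scalerDr !scalerA {1}hd1 hd2 ![_ * b1]mulrC ![_ * b2]mulrC -hd1 -hd2.
- move=> d e s y Ss [Sy [b Cb [z [Sz hz exy]]]]; split; first exact: (filtM fS).
  exists b => //; exists (s * z); split.
  + case: (ltnP d h) => dh; first by rewrite hz // mulr0.
    by rewrite -addnBA //; exact: (filtM fS).
  + by move=> edh; rewrite hz ?mulr0 //; lia.
  + by rewrite mulrCA exy scalerAr.
Qed.

(** The ideal quotient of [b] by [x], in the Rees ring. *)
Let N b d (z : W) : Prop := S d z /\ exists2 y, S (d + h)%N y & x * z = b *: y.

(** The elementary divisors of multiplication by [x] from degree [d] to degree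
    [d + h]. *)
Let N_lspan d : exists2 b0, C b0 & forall b b1, C b -> b = b0 * b1 ->
  exists G : seq W, {in G, forall g, N b d g /\ (mS d g \/ F1 d g)} /\
    forall z, N b d z -> lspan G z.
Proof.
have [l hl kl] := fgS d; have [l' hl' kl'] := fgS (d + h)%N.
have [s [y [y_gen y_span y_free]]] := free_basis V_val torsionfree l'.
have Sy i : S (d + h)%N (y i).
  exact: lspan_sub (filt_submod fS (d + h)) hl' _ (y_span i).
pose lin (c : 'rV[V]_s) : W := \sum_i c 0 i *: y i.
have linP v (c1 c2 : 'rV[V]_s) : lin (v *: c1 + c2) = v *: lin c1 + lin c2.
  rewrite /lin scaler_sumr -big_split /=; apply: eq_bigr => i _.
  by rewrite !mxE scalerDl scalerA.
have linZ v (c1 : 'rV[V]_s) : lin (v *: c1) = v *: lin c1.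
  by rewrite /lin scaler_sumr; apply: eq_bigr => i _; rewrite !mxE scalerA.
have lin0 : lin 0 = 0 by rewrite /lin big1 // => i _; rewrite mxE scale0r.
have linN (c1 : 'rV[V]_s) : lin (- c1) = - lin c1 by rewrite -scaleN1r linZ scaleN1r.
have lin_inj c1 c2 : lin c1 = lin c2 -> c1 = c2.
  move=> e; apply/eqP; rewrite -subr_eq0; apply/eqP; apply: y_free.
  change (lin (c1 - c2) = 0).
  by rewrite addrC -scaleN1r linP e scaleN1r addNr.
have Slin c : S (d + h)%N (lin c).
  by apply: submod_sum; [exact: filt_submod | move=> i; exact: SZ].
have [g hg] : exists g : W -> 'rV[V]_s, forall z, S d z -> x * z = lin (g z).
  have hc z : exists c, S d z -> x * z = lin c.
    case: (pselect (S d z)) => [Sz|?]; last by exists 0.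
    have [|c ec] := y_gen (x * z); last by exists c.
    by apply: kl'; rewrite addnC; exact: (filtM fS).
  by have [g hg] := choice hc; exists g.
pose L := [seq (z, g z) | z <- l] : seq (W * 'rV[V]_s).
have spanL (q : W * 'rV[V]_s) : lspan L q -> S d q.1 /\ x * q.1 = lin q.2.
  apply: (@lspan_sub _ _ L (fun q : W * 'rV[V]_s => S d q.1 /\ x * q.1 = lin q.2)).
    split; first by rewrite mulr0 /= lin0.
    move=> v q1 q2 [S1 e1] [S2 e2]; split; first by apply: SD => //; exact: SZ.
    by rewrite /= linP mulrDr -scalerAr e1 e2.
  by move=> _ /mapP[z lz ->] /=; split; [exact: hl | apply: hg; exact: hl].
have Lspan z : S d z -> lspan L (z, g z).
  move=> Sz; have : lspan l z by exact: kl.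
  move/(lspan_sub (P := fun z => exists c, lspan L (z, c))) => [||c Lc].
  - split; first by exists 0; case: (lspan_submod L).
    move=> v z1 z2 [c1 h1] [c2 h2]; exists (v *: c1 + c2).
    by have [_ /(_ v _ _ h1 h2)] := lspan_submod L.
  - by move=> y' ly; exists (g y'); apply: mem_lspan; apply: map_f.
  have [_ /= e] := spanL _ Lc; rewrite hg // in e.
  by rewrite (lin_inj _ _ e).
have [b0 Cb0 hb0] := divisor_lattice V_val V_max C0 C1 C_dvd C_nomax L.
exists b0 => // b b1 Cb eb; have [G [hG kG]] := hb0 b b1 Cb eb.
exists [seq q.1 | q <- G]; split.
  move=> _ /mapP[q Gq ->]; have [Lq [[v ev] hq]] := hG q Gq.
  have [Sq eq] := spanL _ Lq; split.
    by split=> //; exists (lin v) => //; rewrite eq ev linZ.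
  case: hq => [[b' Cb' [v' ev']]|[t [q' [mt [Lq' eqq']]]]]; [right | left].
    by split=> //; exists b' => //; exists (lin v') => //; rewrite eq ev' linZ.
  exists t, q'.1; split=> //; first by case: (spanL _ Lq').
  by rewrite eqq'.
move=> z [Sz [y' Sy' e]].
have /kG : lspan L (z, g z) by exact: Lspan.
have [c ec] := y_gen y' (kl' _ Sy').
have -> : (z, g z).2 = b *: c.
  by apply: lin_inj; rewrite /= -hg // e ec linZ.
move=> /(_ (ex_intro _ c erefl)).
apply: (lspan_sub (P := fun q : W * 'rV[V]_s => lspan [seq q.1 | q <- G] q.1)).
  split; first by case: (lspan_submod (Q := W) [seq q.1 | q <- G]).
  by move=> v q1 q2; case: (lspan_submod (Q := W) [seq q.1 | q <- G]) => _; apply.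
by move=> q Gq; apply: mem_lspan; exact: map_f.
Qed.

(** Multiply together the elements given by [S_loc]. *)
Lemma common_multiplier (G : seq (nat * W)) :
  {in G, forall g, S g.1 g.2 /\ g.2 \in n} ->
  exists e s, [/\ S e s, s \notin n & {in G, forall g, mS (e + g.1)%N (s * g.2)}].
Proof.
elim: G => [|g G IHG] hG.
  by exists 0%N, 1; split=> //; [exact: filt1 | rewrite n_unit unitr1].
have [|e2 [s2 [S2 n2 h2]]] := IHG; first by move=> g' Gg; apply: hG; rewrite inE Gg orbT.
have [Sg ng] := hG g (mem_head _ _); have [e1 [s1 [S1 n1 h1]]] := S_loc Sg ng.
exists (e1 + e2)%N, (s1 * s2); split; first exact: (filtM fS).
  by move: n1 n2; rewrite !n_unit !negbK unitrM => -> ->.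
move=> g'; rewrite inE => /orP[/eqP->|/h2 m2].
  rewrite [s1 * _]mulrC -mulrA [(e1 + e2)%N]addnC -addnA.
  exact: max_mulM.
by rewrite -mulrA -addnA; exact: max_mulM.
Qed.

Let upper (l : seq V) : {in l, forall a, C a} ->
  exists2 b, C b & {in l, forall a, exists2 t, t \in m & b = a * t}.
Proof.
elim: l => [|a l IHl] hl; first by exists 1.
have [|b1 Cb1 hb1] := IHl; first by move=> a' la; apply: hl; rewrite inE la orbT.
have [c Cc [[d1 e1] [d2 e2]]] := C_lub (hl a (mem_head _ _)) Cb1.
have [t mt Cct] := C_nomax Cc; exists (c * t) => // a'.
rewrite inE => /orP[/eqP->|/hb1[t' mt' et']].
  by exists (d1 * t); rewrite ?maxM // e1 mulrA.
by exists (t' * d2 * t); rewrite ?maxM // e2 et' !mulrA.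
Qed.

(** The pair of [z] and [y] is divisible by one element of [m], by which the
    equation may be simplified. *)
Let N_div b d z y : C b -> mS d z -> mS (d + h)%N y -> x * z = b *: y ->
  exists t z1, [/\ t \in m, N b d z1 & z = t *: z1].
Proof.
move=> Cb [u [z1 [mu Sz1 ez]]] [v [y1 [mv Sy1 ey]]] e.
have [t mt [[a ea] [c ec]]] := max_gcd V_val mu mv.
case: (eqVneq t 0) => [t0|t0].
  exists 0, 0; split; first exact: max0 V_max.
    by split=> //; exists 0 => //; rewrite mulr0 scaler0.
  by rewrite scaler0 ez ea t0 mul0r scale0r.
exists t, (a *: z1); split=> //; last by rewrite ez ea scalerA.
split; first exact: SZ.
exists (c *: y1); first exact: SZ.
apply: (scale_inj t0); transitivity (x * z); first by rewrite ez ea -!scalerA !scalerAr.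
by rewrite e ey ec !scalerA; congr (_ *: _); ring.
Qed.

(** The elements [g.2] for [g] in [G1] and [v g] for [g] in [G2] are lifts to
    [N b] of the generators of [F1] and [F2]: modulo [m], their pairs
    [(z, x z / b)] are [(g.2, 0)] and [(0, g.2)].  Since [e0] multiplies these
    pairs into [m], it multiplies the lifts into [m N b].  Conversely every
    element of [N b] of a degree in [D] is a combination of the lifts modulo
    [m N b].  The finite set [D] contains the degrees that occur, so that [b]
    can be chosen after them. *)
Lemma content_contradiction : False.
Proof.
have [G1 hG1 kG1] := nS F1_gideal.
have [G2 hG2 kG2] := nS F2_gideal.
have [|eps [e0 [Se0 ne0 he0]]] := @common_multiplier (G1 ++ G2).
  move=> g; rewrite mem_cat => /orP[/hG1 Fg|/hG2 Fg].
    by split; [case: Fg | exact: F1_max Fg].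
  by split; [case: Fg | exact: F2_max Fg].
have Ue0 : e0 \is a GRing.unit by move: ne0; rewrite n_unit negbK.
have [bz hbz] : exists bz : nat * W -> V * W, {in G2, forall g, C (bz g).1 /\
    [/\ S (g.1 - h)%N (bz g).2, (g.1 < h)%N -> (bz g).2 = 0 &
        x * (bz g).2 = (bz g).1 *: g.2]}.
  apply: (finite_choice (Q := fun g (p : V * W) => C p.1 /\
    [/\ S (g.1 - h)%N p.2, (g.1 < h)%N -> p.2 = 0 & x * p.2 = p.1 *: g.2])).
    by move=> g /hG2[Sg [b Cb [z hz]]]; exists (b, z).
  by exists (0, 0).
have N_lspan_ex d : exists b0, C b0 /\ forall b b1, C b -> b = b0 * b1 ->
    exists G : seq W, {in G, forall g, N b d g /\ (mS d g \/ F1 d g)} /\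
      forall z, N b d z -> lspan G z.
  by have [b0 Cb0 hb0] := N_lspan d; exists b0.
have [b0 hb0] := choice N_lspan_ex.
(* The degrees come from [G1], [G2] and [eps] only, so that [b] may depend on
   them. *)
pose D := 0%N :: [seq (eps + g.1)%N | g <- G1] ++ [seq (eps + (g.1 - h))%N | g <- G2].
have [|b Cb hb] := @upper ([seq b0 d | d <- D] ++ [seq (bz g).1 | g <- G2]).
  move=> a; rewrite mem_cat => /orP[/mapP[d _ ->]|/mapP[g Gg ->]].
    by case: (hb0 d).
  by case: (hbz g Gg).
have b_neq0 := C_neq0 Cb.
have [Gd hGd] : exists Gd : nat -> seq W, {in D, forall d,
    {in Gd d, forall g, N b d g /\ (mS d g \/ F1 d g)} /\
    forall z, N b d z -> lspan (Gd d) z}.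
  apply: (finite_choice (Q := fun d (G : seq W) =>
    {in G, forall g, N b d g /\ (mS d g \/ F1 d g)} /\
    forall z, N b d z -> lspan G z)); last by exists [::].
  move=> d Dd; have [|t _ eb] := hb (b0 d); first by rewrite mem_cat map_f.
  by case: (hb0 d) => _ /(_ b t Cb eb).
have [mu hmu] : exists mu : nat * W -> V,
    {in G2, forall g, mu g \in m /\ b = (bz g).1 * mu g}.
  apply: (finite_choice (Q := fun g t => t \in m /\ b = (bz g).1 * t)).
    move=> g Gg; have [|t mt eb] := hb (bz g).1; last by exists t.
    by rewrite mem_cat (map_f (fun g => (bz g).1)) ?orbT.
  by exists 0.
pose v g := mu g *: (bz g).2.
pose l := [seq g.2 | g <- G1] ++ [seq v g | g <- G2] ++ flatten [seq Gd d | d <- D].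
have [I0 ID IM] := nspan_ideal n l.
have IZ c z : nspan n l z -> nspan n l (c *: z).
  by move=> Iz; rewrite -[z]mul1r scalerAl; exact: IM.
have N_nspan d z t : d \in D -> t \in m -> N b d z -> nspan n l (t *: z).
  move=> Dd mt Nz; have [_ /(_ z Nz)] := hGd d Dd.
  apply: (lspan_sub (P := fun z => nspan n l (t *: z))).
    split; first by rewrite scaler0.
    by move=> c y z' hy hz; rewrite scalerDr scalerA mulrC -scalerA; apply: (ID) => //; exact: IZ.
  move=> y Gy; rewrite -[y]mul1r scalerAl => P iP; apply.
    by apply/n_max; exists t, 1.
  by rewrite 2!mem_cat; apply/or3P; apply: Or33; apply/flattenP; exists (Gd d) => //; exact: map_f.
have G1F g : g \in G1 -> exists y, [/\ mS (g.1 + h)%N y & x * g.2 = b *: y].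
  move=> /hG1[_ [b' Cb' [y Sy e]]]; have [t mt eb'] := cut_dvd Cb Cb'.
  by exists (t *: y); rewrite e eb' scalerA; split=> //; exists t, y.
have G1_nspan g : g \in G1 -> nspan n l g.2.
  move=> Gg; have [y [my e]] := G1F g Gg.
  have [||||t [z1 [mt Nz1 ez]]] := @N_div b (eps + g.1)%N (e0 * g.2) (e0 * y) => //.
  - by apply: he0; rewrite mem_cat Gg.
  - by rewrite -addnA; exact: max_mulM.
  - by rewrite mulrCA e scalerAr.
  rewrite -[g.2](mulKr Ue0) ez; apply: IM; apply: N_nspan mt Nz1.
  by rewrite inE mem_cat (map_f (fun g => (eps + g.1)%N)) ?orbT.
have G2_eq g : g \in G2 -> x * v g = b *: g.2.
  move=> Gg; have [_ [_ _ e]] := hbz g Gg; have [_ eb] := hmu g Gg.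
  by rewrite /v -scalerAr e scalerA mulrC -eb.
have G2_mS g : g \in G2 -> mS (g.1 - h)%N (v g).
  move=> Gg; have [_ [Sz _ _]] := hbz g Gg; have [mmu _] := hmu g Gg.
  by exists (mu g), (bz g).2.
have G2_nspan g : g \in G2 -> nspan n l (v g).
  move=> Gg; case: (ltnP g.1 h) => gh.
    by have [_ [_ /(_ gh) e _]] := hbz g Gg; rewrite /v e scaler0.
  have [||||t [z1 [mt Nz1 ez]]] := @N_div b (eps + (g.1 - h))%N (e0 * v g) (e0 * g.2) => //.
  - by apply: max_mulM => //; exact: G2_mS.
  - by rewrite -addnA subnK //; apply: he0; rewrite mem_cat Gg orbT.
  - by rewrite mulrCA G2_eq // scalerAr.
  rewrite -[v g](mulKr Ue0) ez; apply: IM; apply: N_nspan mt Nz1.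
  by rewrite inE mem_cat (map_f (fun g => (eps + (g.1 - h))%N)) ?orbT.
(* [J1] contains the generators of [F1], hence [F1]: each [z] in [F1] is modulo
   [m] an element [zeta] of [N b] with [x zeta / b] a multiple of [m]. *)
pose J1 d z := S d z /\ exists zeta y, [/\ S d zeta, nspan n l zeta,
  mS (d + h)%N y, x * zeta = b *: y & mS d (z - zeta)].
have gJ1 : graded_ideal S J1.
  split.
  - by move=> d z [].
  - move=> d; split=> //; exists 0, 0; rewrite mulr0 scaler0 subr0.
    by split=> //; exact: max_mul0.
  - move=> d z1 z2 [S1 [c1 [y1 [Sc1 I1 m1 e1 d1]]]] [S2 [c2 [y2 [Sc2 I2 m2 e2 d2]]]].
    split; first exact: SD.
    exists (c1 + c2), (y1 + y2); rewrite mulrDr e1 e2 scalerDr opprD addrACA.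
    by split=> //; [exact: SD | exact: ID | exact: max_mulD | exact: max_mulD].
  - move=> d e s z Ss [Sz [c1 [y1 [Sc1 I1 m1 e1 d1]]]]; split; first exact: (filtM fS).
    exists (s * c1), (s * y1); rewrite mulrCA e1 scalerAr -mulrBr -addnA.
    by split=> //; [exact: (filtM fS) | exact: IM | exact: max_mulM | exact: max_mulM].
have F1J1 d z : F1 d z -> J1 d z.
  apply: kG1; split=> //.
    move=> {}d {}z mz; split; first exact: (max_mul_sub fS mz).
    exists 0, 0; rewrite mulr0 scaler0 subr0.
    by split=> //; exact: max_mul0.
  move=> g Gg; have [Sg _] := hG1 g Gg; split=> //.
  have [y [my e]] := G1F g Gg; exists g.2, y; rewrite subrr.
  by split=> //; [exact: G1_nspan | exact: max_mul0].
(* Likewise each [y] in [F2] is modulo [m] of the form [x z / b] with [z] in [N b]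
   a multiple of [m]. *)
pose J2 d y := S d y /\ exists z y0, [/\ (d < h)%N -> z = 0, mS (d - h)%N z /\
  nspan n l z, S d y0, x * z = b *: y0 & mS d (y - y0)].
have gJ2 : graded_ideal S J2.
  split.
  - by move=> d z [].
  - move=> d; split=> //; exists 0, 0; rewrite mulr0 scaler0 subr0.
    by split=> //; [split=> //; exact: max_mul0 | exact: max_mul0].
  - move=> d y1 y2 [S1 [z1 [w1 [h1 [m1 I1] Sw1 e1 d1]]]] [S2 [z2 [w2 [h2 [m2 I2] Sw2 e2 d2]]]].
    split; first exact: SD.
    exists (z1 + z2), (w1 + w2); rewrite mulrDr e1 e2 scalerDr opprD addrACA.
    split=> //; [|split|exact: SD|exact: max_mulD].
    + by move=> dh; rewrite h1 // h2 // addr0.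
    + exact: max_mulD.
    + exact: ID.
  - move=> d e s y Ss [Sy [z1 [w1 [h1 [m1 I1] Sw1 e1 d1]]]]; split; first exact: (filtM fS).
    exists (s * z1), (s * w1); rewrite mulrCA e1 scalerAr -mulrBr.
    split=> //; [|split|exact: (filtM fS)|exact: max_mulM].
    + by move=> edh; rewrite h1 ?mulr0 //; lia.
    + case: (ltnP d h) => dh; first by rewrite h1 // mulr0; exact: max_mul0.
      by rewrite -addnBA //; exact: max_mulM.
    + exact: IM.
have F2J2 d z : F2 d z -> J2 d z.
  apply: kG2; split=> //.
    move=> {}d {}z mz; split; first exact: (max_mul_sub fS mz).
    exists 0, 0; rewrite mulr0 scaler0 subr0.
    by split=> //; split=> //; exact: max_mul0.
  move=> g Gg; have [Sg _] := hG2 g Gg; split=> //.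
  exists (v g), g.2; rewrite subrr; split=> //.
  - by move=> gh; have [_ [_ /(_ gh) e _]] := hbz g Gg; rewrite /v e scaler0.
  - by split; [exact: G2_mS | exact: G2_nspan].
  - exact: G2_eq.
  - exact: max_mul0.
(* Subtracting from [g] the two lifts leaves a pair divisible by an element of
   [m]. *)
have Gd_nspan d g : d \in D -> g \in Gd d -> nspan n l g.
  move=> Dd Gg; have [/(_ g Gg) [[Sg [y Sy e]] hg] _] := hGd d Dd.
  have [_ [z1 [y1 [Sz1 I1 my1 e1 mz1]]]] : J1 d g.
    case: hg => [mg|/F1J1 //]; split=> //.
    exists 0, 0; rewrite mulr0 scaler0 subr0.
    by split=> //; exact: max_mul0.
  have /F2J2[_ [z2 [y2 [_ [mz2 I2] Sy2 e2 my2]]]] : F2 (d + h)%N y.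
    split=> //; exists b => //; exists g; rewrite addnK; split=> //; lia.
  rewrite addnK in mz2.
  have mN e' y' : mS e' y' -> mS e' (- y').
    by rewrite -scaleN1r; exact: max_mulZ.
  have [|||t [z' [mt Nz' ez]]] := @N_div b d (g - z1 - z2) (y - y2 - y1) Cb.
  - by apply: max_mulD => //; exact: mN.
  - by apply: max_mulD => //; exact: mN.
  - by rewrite !mulrBr e e1 e2 !scalerBr addrAC.
  have -> : g = t *: z' + z2 + z1 by rewrite -ez !subrK.
  apply: (ID) => //; apply: (ID) => //; exact: N_nspan Nz'.
have l0 : {in l, forall z, z = 0}.
  apply: (nakayama n_unit max_extD) => z; rewrite 2!mem_cat => /or3P[].
  - by case/mapP=> g Gg ->; exact: G1_nspan.
  - by case/mapP=> g Gg ->; exact: G2_nspan.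
  - by case/flattenP=> G /mapP[d Dd ->]; exact: Gd_nspan.
(* [b] is in [N b] in degree 0, as [x b = b x]. *)
have : lspan (Gd 0%N) (b%:A : W).
  have [|_] := hGd 0%N; first exact: mem_head.
  apply; split; first by apply: SZ; exact: filt1.
  by exists x => //; rewrite -scalerAr mulr1.
move=> hb1; have /torsionfree[/eqP|/eqP] : b%:A = 0 :> W.
  apply: (lspan_sub (P := fun z : W => z = 0) _ _ hb1).
    by split=> // c _ _ -> ->; rewrite scaler0 addr0.
  move=> y Gy; apply: l0; rewrite 2!mem_cat; apply/or3P; apply: Or33; apply/flattenP.
  by exists (Gd 0%N) => //; exact/map_f/mem_head.
- by rewrite (negPf b_neq0).
- by rewrite oner_eq0.
Qed.
End Content.

(** Existence of contents; the statement collects what is used of [W] and of the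
    filtration. *)
Theorem content (V : idomainType) (m : {pred V}) (W : comUnitAlgType V)
    (n : {pred W}) (S : nat -> W -> Prop) :
  valuation_ring V -> maximal_ideal m ->
  (forall (a : V) (x : W), a *: x = 0 -> a = 0 \/ x = 0) ->
  (forall x : W, (x \in n) = (x \isn't a GRing.unit)) ->
  (forall w : W, w \in n <-> exists mu w', mu \in m /\ w = mu *: w') ->
  filtration S -> fg_pieces S -> noetherian m S ->
  (forall d z, S d z -> z \in n ->
    exists e s, [/\ S e s, s \notin n & max_mul m S (e + d)%N (s * z)]) ->
  forall h x, S h x -> x != 0 -> exists b u, u \is a GRing.unit /\ x = b *: u.
Proof.
move=> Vv Vm tf nu nm fS fgS nS loc h x Sx x0.
apply: contrapT => H; apply: (content_contradiction Vv Vm tf nu nm fS fgS nS loc Sx x0).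
by move=> b u e; apply/negP => Uu; apply: H; exists b, u.
Qed.

(** * Relations in flat modules *)

(** Quotient modules, used only through [quotient_module] and
    [quotient_factor]. *)
Section QuotientModule.
Variables (R : comNzRingType) (M : lmodType R) (U : zmodClosed M).
Hypothesis UZ : forall a x, x \in U -> a *: x \in U.

(** The hypothesis [UZ] is an argument because the scaling action, attached to
    this type, needs it. *)
Definition quot_mod of (forall a x, x \in U -> a *: x \in U) : Type :=
  Quotient.quot U.
Local Notation Q := (quot_mod UZ).
HB.instance Definition _ := GRing.Zmodule.on Q.

Let p (x : M) : Q := \pi_(Quotient.quot U) x.

Let p_eq x y : p x = p y <-> x - y \in U.
Proof.
split=> [/eqP|h].
  by rewrite /p -Quotient.idealrBE.
by apply/eqP; rewrite /p -Quotient.idealrBE.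
Qed.

Let pD x y : p (x + y) = p x + p y.
Proof. exact: (raddfD (\pi_(Quotient.quot U))). Qed.

Let pK (q : Q) : p (repr q) = q.
Proof. exact: reprK. Qed.

Let qscale (a : R) (q : Q) : Q := p (a *: repr q).

Let qscaleE a x : qscale a (p x) = p (a *: x).
Proof.
apply/p_eq; rewrite -scalerBr; apply/UZ/p_eq; exact: pK.
Qed.

Fact qscaleA a b v : qscale a (qscale b v) = qscale (a * b) v.
Proof. by rewrite -[v]pK !qscaleE scalerA. Qed.

Fact qscale1 : left_id 1 qscale.
Proof. by move=> v; rewrite -[v]pK !qscaleE scale1r. Qed.

Fact qscaleDr : right_distributive qscale +%R.
Proof.
by move=> a u v; rewrite -[u]pK -[v]pK -pD !qscaleE scalerDr pD.
Qed.

Fact qscaleDl v : {morph qscale^~ v : a b / a + b}.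
Proof. by move=> a b; rewrite -[v]pK !qscaleE scalerDl pD. Qed.

HB.instance Definition _ :=
  GRing.Zmodule_isLmodule.Build R Q qscaleA qscale1 qscaleDr qscaleDl.

Fact quot_proj_linear : linear p.
Proof. by move=> a x y; rewrite pD -qscaleE. Qed.

Lemma quot_proj : exists p : {linear M -> Q},
  (forall q, exists x, p x = q) /\ forall x, p x = 0 <-> x \in U.
Proof.
pose f : {linear M -> Q} :=
  HB.pack p (GRing.isLinear.Build R M Q *:%R p quot_proj_linear).
exists f; split=> [q|x]; first by exists (repr q); exact: pK.
have f0 : p 0 = 0 by exact: (raddf0 f).
by rewrite -[in _ = 0]f0 -[in x \in U](subr0 x); exact: p_eq.
Qed.
End QuotientModule.

Definition is_quotient (R : comNzRingType) (M Q : lmodType R) (P : M -> Prop)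
    (p : {linear M -> Q}) : Prop :=
  (forall q, exists x, p x = q) /\ forall x, p x = 0 <-> P x.

Lemma quotient_module (R : comNzRingType) (M : lmodType R) (P : M -> Prop) :
  submodP P -> exists (Q : lmodType R) (p : {linear M -> Q}), is_quotient P p.
Proof.
case=> P0 Plin; pose S : {pred M} := [pred x | `[< P x >]].
have closedS : GRing.submod_closed S.
  split; first by apply/asboolP.
  by move=> a x y /asboolP Px /asboolP Py; apply/asboolP; exact: Plin.
pose U : zmodClosed M := HB.pack (S : M -> bool)
  (GRing.isZmodClosed.Build M S (GRing.submod_closedB closedS)).
have UZ a x : x \in U -> a *: x \in U.
  by move/asboolP=> Px; apply/asboolP; exact: (submodZ _ (conj P0 Plin)).
have [p [psurj pker]] := quot_proj UZ.
exists (quot_mod UZ), p; split=> // x.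
by rewrite pker; split=> [/asboolP|?] //; apply/asboolP.
Qed.

Lemma quotient_factor (R : comNzRingType) (M Q X : lmodType R) (P : M -> Prop)
    (p : {linear M -> Q}) (f : {linear M -> X}) :
  is_quotient P p -> (forall x, P x -> f x = 0) ->
  exists g : {linear Q -> X}, forall x, g (p x) = f x.
Proof.
case=> psurj pker fP; have [s sK] := choice psurj.
have sE x : f (s (p x)) = f x.
  apply/eqP; rewrite -subr_eq0 -linearB; apply/eqP/fP/pker.
  by rewrite linearB sK subrr.
have glin : linear (f \o s).
  by move=> a x y /=; rewrite -{1}(sK x) -{1}(sK y) -!linearP sE.
pose g : {linear Q -> X} :=
  HB.pack (f \o s) (GRing.isLinear.Build R Q X *:%R (f \o s) glin).
by exists g.
Qed.

Section Flat.
Variables (R : comNzRingType) (M : lmodType R).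

(** The submodule [J M] of [M]. *)
Definition ideal_mul (J : R -> Prop) (y : M) : Prop := forall P, submodP P ->
  (forall a z, J a -> P (a *: z)) -> P y.

Lemma ideal_mul_submod J : submodP (ideal_mul J).
Proof.
split=> [P [] //|v x y hx hy P sP hP].
by case: (sP) => _; apply; [exact: hx | exact: hy].
Qed.

(** [R / J] tensored with [M] is [M / J M].  These are the only tensor products
    needed. *)
Lemma tensor_cyclic (J : R -> Prop) (N T : lmodType R)
    (p : {linear R^o -> N}) (q : {linear M -> T}) :
  is_quotient (J : R^o -> Prop) p -> is_quotient (ideal_mul J) q ->
  exists2 b : {bilinear N -> M -> T}, is_tensor b &
    forall a y, b (p a) y = q (a *: y).
Proof.
move=> [psurj pker] qq; have [qsurj qker] := qq.
have [s sK] := choice psurj.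
have sE a y : q (s (p a) *: y) = q (a *: y).
  apply/eqP; rewrite -subr_eq0 -linearB -scalerBl; apply/eqP/qker => P sP; apply.
  by apply/pker; rewrite linearB sK subrr.
pose b0 (x : N) (y : M) := q (s x *: y).
have b0_bilin : bilinear_for (GRing.Scale.Law.clone _ _ *:%R _)
    (GRing.Scale.Law.clone _ _ *:%R _) b0.
  split=> [y a x1 x2|x a y1 y2]; rewrite /b0 /=.
    rewrite -{1}(sK x1) -{1}(sK x2) -linearP sE scalerDl linearD; congr (_ + _).
    by rewrite -[_ *: s x1]/(a * s x1) -scalerA linearZ.
  by rewrite scalerDr linearD scalerA mulrC -scalerA linearZ.
pose b : {bilinear N -> M -> T} :=
  HB.pack b0 (@bilinear_isBilinear.Build R N M T _ _ b0 b0_bilin).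
have bE a y : b (p a) y = q (a *: y) by exact: sE.
exists b => // P c.
have cp a y : c (p a) y = c (p 1) (a *: y).
  have -> : p a = a *: p 1 by rewrite -linearZ /= /(_ *: _) /= mulr1.
  by rewrite linearZl_LR linearZr_LR.
pose c1 : {linear M -> P} := c (p 1).
have [y Jy|h hE] := quotient_factor (f := c1) qq.
  apply: (Jy (fun y => c1 y = 0)).
    by split=> [|v y1 y2 e1 e2]; rewrite ?linear0 // linearP e1 e2 scaler0 addr0.
  move=> a z Ja; transitivity (c (p a) z); first by rewrite cp.
  by have -> : p a = 0 by [apply/pker]; rewrite linear0l.
exists h.
  by move=> x y; have [a <-] := psurj x; rewrite bE hE cp.
move=> h' h'E t; have [y <-] := qsurj t.
by rewrite hE -[y]scale1r -bE h'E.
Qed.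

(** Multiplication by [r] embeds [R / (mu : r)] into [R / mu R].  By flatness it
    embeds [M / (mu : r) M] into [M / mu M], where the class of [y] goes to that
    of [r y = mu w], which is zero. *)
Theorem flat_relation (r mu : R) (y w : M) : flat M ->
  r *: y = mu *: w -> ideal_mul (fun a => exists b, r * a = mu * b) y.
Proof.
move=> flatM eyw.
pose J a := exists b, r * a = mu * b.
pose I a := exists b, a = mu * b.
have sJ : submodP (J : R^o -> Prop).
  split; first by exists 0; rewrite !mulr0.
  move=> v a1 a2 [b1 e1] [b2 e2]; exists (v * b1 + b2).
  by rewrite mulrDr [in RHS]mulrDr e2 -/(v * a1) mulrCA e1 mulrCA.
have sI : submodP (I : R^o -> Prop).
  split; first by exists 0; rewrite mulr0.
  move=> v _ _ [b1 ->] [b2 ->]; exists (v * b1 + b2).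
  by rewrite mulrDr mulrCA.
have [N' [p' qp']] := quotient_module sJ.
have [N [p qp]] := quotient_module sI.
have [T' [q' qq']] := quotient_module (ideal_mul_submod J).
have [T [q qq]] := quotient_module (ideal_mul_submod I).
have [b' tb' b'E] := tensor_cyclic qp' qq'.
have [b tb bE] := tensor_cyclic qp qq.
have [f fE] : exists f : {linear N' -> N}, forall a, f (p' a) = p (r *: a : R^o).
  pose pr : {linear R^o -> N} := p \o ( *:%R r).
  have [a [c e]|f fE] := quotient_factor (f := pr) qp'; last by exists f.
  by apply/qp.2; exists c.
have [g gE] : exists g : {linear T' -> T}, forall x, g (q' x) = q (r *: x).
  pose qr : {linear M -> T} := q \o ( *:%R r).
  have [x Jx|g gE] := quotient_factor (f := qr) qq'; last by exists g.
  apply/qq.2; apply: (Jx (fun x => ideal_mul I (r *: x))).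
    split; first by rewrite scaler0; case: (ideal_mul_submod I).
    move=> v x1 x2 h1 h2; rewrite scalerDr scalerA mulrC -scalerA.
    by case: (ideal_mul_submod I) => _; apply.
  by move=> a z [c e] P sP hP; rewrite scalerA; apply: hP; exists c.
have f_inj : injective f.
  move=> x1 x2 e; apply/eqP; rewrite -subr_eq0; apply/eqP.
  have [a ea] := qp'.1 (x1 - x2); rewrite -ea; apply/qp'.2.
  have : f (p' a) = 0 by rewrite ea linearB e subrr.
  by rewrite fE => /qp.2.
have g_inj : injective g.
  apply: (flatM _ _ f f_inj _ _ b' b tb' tb) => x z.
  have [a <-] := qp'.1 x.
  by rewrite b'E gE fE bE scalerA.
apply/qq'.2/g_inj; rewrite gE linear0; apply/qq.2.
by rewrite eyw => P sP hP; apply: hP; exists 1; rewrite mulr1.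
Qed.
End Flat.

(** * Filtered colimits of algebras *)

(** The universal property alone does not tell when two elements of the system
    become equal in the colimit, so the colimit is built from classes of germs
    and compared with [B]. *)
Section FilteredColimit.
Variables (A : comNzRingType) (d : Order.disp_t) (I : preorderType d).
Variables (F : inductive_system A I) (I_filtered : filtered I).

Lemma sys_map_irr i j (p q : (i <= j)%O) : sys_map F p =1 sys_map F q.
Proof. by rewrite (bool_irrelevance p q). Qed.

Lemma sys_mapK i j k (p : (i <= j)%O) (q : (j <= k)%O) (r : (i <= k)%O) x :
  sys_map F q (sys_map F p x) = sys_map F r x.
Proof. exact: (sys_map_comp p q r x). Qed.

Let upper i j : exists k : I, (i <= k)%O /\ (j <= k)%O.
Proof. by case: I_filtered => _; apply. Qed.

Definition germ : Type := {i : I & F i}.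
HB.instance Definition _ := gen_eqMixin germ.
HB.instance Definition _ := gen_choiceMixin germ.

Definition germ_eq (x y : germ) : bool :=
  `[< exists k (p : (tag x <= k)%O) (q : (tag y <= k)%O),
        sys_map F p (tagged x) = sys_map F q (tagged y) >].

Fact germ_eq_refl : reflexive germ_eq.
Proof. by move=> x; apply/asboolP; exists (tag x), (Order.le_refl _), (Order.le_refl _). Qed.

Fact germ_eq_sym : symmetric germ_eq.
Proof.
suff imp x y : germ_eq x y -> germ_eq y x by move=> x y; apply/idP/idP; exact: imp.
by move=> /asboolP[k [p [q e]]]; apply/asboolP; exists k, q, p.
Qed.

Fact germ_eq_trans : transitive germ_eq.
Proof.
move=> y x z /asboolP[k [p [q e]]] /asboolP[k' [p' [q' e']]]; apply/asboolP.
have [l [kl kl']] := upper k k'.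
have xl := Order.le_trans p kl; have zl := Order.le_trans q' kl'.
exists l, xl, zl.
have yl := Order.le_trans q kl.
rewrite -(sys_mapK p kl) e (sys_mapK q kl yl) -(sys_mapK p' kl' yl) e'.
exact: sys_mapK.
Qed.

Canonical germ_equiv := EquivRel germ_eq germ_eq_refl germ_eq_sym germ_eq_trans.

(** The ring operations depend on the system being filtered, so the type carries
    the proof. *)
Definition colim of filtered I : Type := {eq_quot germ_eq}.
Local Notation L := (colim I_filtered).
HB.instance Definition _ := Choice.copy L {eq_quot germ_eq}.

Definition cin i (x : F i) : L := \pi_{eq_quot germ_eq} (existT _ i x : germ).

Lemma cin_tagged (g : germ) : cin (tagged g) = \pi_{eq_quot germ_eq} g :> L.
Proof. by case: g. Qed.

Lemma cin_eq i j (x : F i) (y : F j) : cin x = cin y <->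
  exists k (p : (i <= k)%O) (q : (j <= k)%O), sys_map F p x = sys_map F q y.
Proof. by split=> [/eqmodP/asboolP //|h]; apply/eqmodP/asboolP. Qed.

Lemma cin_map i j (p : (i <= j)%O) x : cin (sys_map F p x) = cin x.
Proof.
apply/cin_eq; exists j, (Order.le_refl _), p.
by rewrite (sys_map_id (Order.le_refl j)).
Qed.

Lemma cin_surj (z : L) : exists i (x : F i), z = cin x.
Proof.
exists (tag (repr (z : {eq_quot germ_eq}))), (tagged (repr (z : {eq_quot germ_eq}))).
by rewrite cin_tagged; symmetry; exact: reprK.
Qed.

Lemma cin_surj2 (z1 z2 : L) : exists k (x1 x2 : F k), z1 = cin x1 /\ z2 = cin x2.
Proof.
have [i [x ->]] := cin_surj z1; have [j [y ->]] := cin_surj z2.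
have [k [ik jk]] := upper i j.
by exists k, (sys_map F ik x), (sys_map F jk y); rewrite !cin_map.
Qed.

Lemma cin_surj3 (z1 z2 z3 : L) : exists k (x1 x2 x3 : F k),
  [/\ z1 = cin x1, z2 = cin x2 & z3 = cin x3].
Proof.
have [i [x1 [x2 [-> ->]]]] := cin_surj2 z1 z2; have [j [y ->]] := cin_surj z3.
have [k [ik jk]] := upper i j.
exists k, (sys_map F ik x1), (sys_map F ik x2), (sys_map F jk y).
by rewrite !cin_map.
Qed.

Section Operation.
Variable o : forall i, F i -> F i -> F i.
Hypothesis oE : forall i j (p : (i <= j)%O) x y,
  sys_map F p (o x y) = o (sys_map F p x) (sys_map F p y).

(** Representatives at a common index are chosen; by [copE] the choice does not
    matter. *)
Definition cop (z1 z2 : L) : L :=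
  let c := cid (cin_surj2 z1 z2) in
  let c1 := cid (svalP c) in
  let c2 := cid (svalP c1) in
  cin (o (sval c1) (sval c2)).

Lemma copE i (x y : F i) : cop (cin x) (cin y) = cin (o x y).
Proof.
rewrite /cop; case: cid => k /= h; case: cid => x' /= h'; case: cid => y' /= [].
move=> /cin_eq[k1 [p1 [q1 e1]]] /cin_eq[k2 [p2 [q2 e2]]].
have [l [l1 l2]] := upper k1 k2; apply/cin_eq.
exists l, (Order.le_trans q1 l1), (Order.le_trans p1 l1); rewrite !oE.
congr o.
  by rewrite -(sys_mapK q1 l1) -(sys_mapK p1 l1) e1.
rewrite (sys_map_irr _ (Order.le_trans q2 l2)) -(sys_mapK q2 l2) -e2.
exact: sys_mapK.
Qed.
End Operation.

Section Operation1.
Variable o : forall i, F i -> F i.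
Hypothesis oE : forall i j (p : (i <= j)%O) x,
  sys_map F p (o x) = o (sys_map F p x).

Definition cop1 (z : L) : L := cop (fun i x _ => o x) z z.

Lemma cop1E i (x : F i) : cop1 (cin x) = cin (o x).
Proof. by rewrite /cop1 copE // => i' j p x' _; exact: oE. Qed.
End Operation1.

Lemma inhabited_ex (T : Type) : inhabited T -> exists x : T, True.
Proof. by case=> x; exists x. Qed.

Let base : I. Proof. by case: I_filtered => h _; case: (cid (inhabited_ex h)). Qed.

Definition cadd := cop (fun i (x y : F i) => x + y).
Definition cmul := cop (fun i (x y : F i) => x * y).
Definition copp := cop1 (fun i (x : F i) => - x).
Definition cscale (a : A) := cop1 (fun i (x : F i) => a *: x).
Definition czero : L := cin (0 : F base).
Definition cone : L := cin (1 : F base).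

Lemma caddE i (x y : F i) : cadd (cin x) (cin y) = cin (x + y).
Proof. by rewrite /cadd copE // => *; rewrite rmorphD. Qed.
Lemma cmulE i (x y : F i) : cmul (cin x) (cin y) = cin (x * y).
Proof. by rewrite /cmul copE // => *; rewrite rmorphM. Qed.
Lemma coppE i (x : F i) : copp (cin x) = cin (- x).
Proof. by rewrite /copp cop1E // => *; rewrite rmorphN. Qed.
Lemma cscaleE a i (x : F i) : cscale a (cin x) = cin (a *: x).
Proof. by rewrite /cscale cop1E // => *; rewrite linearZ. Qed.
Lemma czeroE i : czero = cin (0 : F i).
Proof.
by apply/cin_eq; have [k [p q]] := upper base i; exists k, p, q; rewrite !rmorph0.
Qed.
Lemma coneE i : cone = cin (1 : F i).
Proof.
by apply/cin_eq; have [k [p q]] := upper base i; exists k, p, q; rewrite !rmorph1.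
Qed.

Fact caddA : associative cadd.
Proof.
move=> z1 z2 z3; have [k [x [y [z [-> -> ->]]]]] := cin_surj3 z1 z2 z3.
by rewrite !caddE addrA.
Qed.
Fact caddC : commutative cadd.
Proof.
move=> z1 z2; have [k [x [y [-> ->]]]] := cin_surj2 z1 z2.
by rewrite !caddE addrC.
Qed.
Fact cadd0 : left_id czero cadd.
Proof. by move=> z; have [k [x ->]] := cin_surj z; rewrite (czeroE k) caddE add0r. Qed.
Fact caddN : left_inverse czero copp cadd.
Proof. by move=> z; have [k [x ->]] := cin_surj z; rewrite (czeroE k) coppE caddE addNr. Qed.

HB.instance Definition _ := GRing.isZmodule.Build L caddA caddC cadd0 caddN.

Fact cmulA : associative cmul.
Proof.
move=> z1 z2 z3; have [k [x [y [z [-> -> ->]]]]] := cin_surj3 z1 z2 z3.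
by rewrite !cmulE mulrA.
Qed.
Fact cmulC : commutative cmul.
Proof.
move=> z1 z2; have [k [x [y [-> ->]]]] := cin_surj2 z1 z2.
by rewrite !cmulE mulrC.
Qed.
Fact cmul1 : left_id cone cmul.
Proof. by move=> z; have [k [x ->]] := cin_surj z; rewrite (coneE k) cmulE mul1r. Qed.
Fact cmulD : left_distributive cmul +%R.
Proof.
move=> z1 z2 z3; have [k [x [y [z [-> -> ->]]]]] := cin_surj3 z1 z2 z3.
by rewrite -[_ + _]/(cadd _ _) -[RHS]/(cadd _ _) caddE !cmulE caddE mulrDl.
Qed.
Fact cone_neq0 : cone != 0.
Proof.
apply/eqP => /cin_eq[k [p [q /eqP]]].
by rewrite rmorph1 rmorph0 oner_eq0.
Qed.

HB.instance Definition _ :=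
  GRing.Zmodule_isComNzRing.Build L cmulA cmulC cmul1 cmulD cone_neq0.

Fact cscaleA a b z : cscale a (cscale b z) = cscale (a * b) z.
Proof. by have [k [x ->]] := cin_surj z; rewrite !cscaleE scalerA. Qed.
Fact cscale1 : left_id 1 cscale.
Proof. by move=> z; have [k [x ->]] := cin_surj z; rewrite !cscaleE scale1r. Qed.
Fact cscaleDr : right_distributive cscale +%R.
Proof.
move=> a z1 z2; have [k [x [y [-> ->]]]] := cin_surj2 z1 z2.
by rewrite -[_ + _]/(cadd _ _) -[RHS]/(cadd _ _) caddE !cscaleE caddE scalerDr.
Qed.
Fact cscaleDl z : {morph cscale^~ z : a b / a + b}.
Proof.
move=> a b; have [k [x ->]] := cin_surj z.
by rewrite -[RHS]/(cadd _ _) !cscaleE caddE scalerDl.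
Qed.
HB.instance Definition _ :=
  GRing.Zmodule_isLmodule.Build A L cscaleA cscale1 cscaleDr cscaleDl.

Fact cscaleAl (a : A) (z1 z2 : L) : a *: (z1 * z2) = (a *: z1) * z2.
Proof.
have [k [x [y [-> ->]]]] := cin_surj2 z1 z2.
rewrite -[LHS]/(cscale a (cmul _ _)) -[RHS]/(cmul (cscale a _) _).
by rewrite cmulE !cscaleE cmulE scalerAl.
Qed.
HB.instance Definition _ := GRing.Lmodule_isLalgebra.Build A L cscaleAl.
HB.instance Definition _ := GRing.Lalgebra_isComAlgebra.Build A L.

Section Cocone.
Variable i : I.
Fact cin_zmod : zmod_morphism (@cin i).
Proof.
move=> x y; rewrite -[RHS]/(cadd _ (copp _)).
by rewrite coppE caddE.
Qed.
Fact cin_monoid : monoid_morphism (@cin i).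
Proof.
split=> [|x y]; first exact/esym/coneE.
by rewrite -[RHS]/(cmul _ _) cmulE.
Qed.
Fact cin_scalable : scalable (@cin i).
Proof. by move=> a x; rewrite -[RHS]/(cscale _ _) cscaleE. Qed.

HB.instance Definition _ := GRing.isZmodMorphism.Build (F i) L (@cin i) cin_zmod.
HB.instance Definition _ := GRing.isMonoidMorphism.Build (F i) L (@cin i) cin_monoid.
HB.instance Definition _ := GRing.isScalable.Build A (F i) L *:%R (@cin i) cin_scalable.
End Cocone.

Section Descent.
Variables (B : comAlgType A) (f : forall i, {lrmorphism F i -> B}).
Hypothesis f_cocone : is_cocone f.

Lemma cocone_eq i j (x : F i) (y : F j) : cin x = cin y -> f i x = f j y.
Proof.
case/cin_eq=> k [p [q e]].
by rewrite -(f_cocone p x) -(f_cocone q y) /= e.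
Qed.

Definition descent_of of is_cocone f := fun z : L =>
  f (tag (repr (z : {eq_quot germ_eq}))) (tagged (repr (z : {eq_quot germ_eq}))).
Local Notation descent := (descent_of f_cocone).

Lemma descentE i (x : F i) : descent (cin x) = f i x.
Proof.
by apply: cocone_eq; rewrite cin_tagged; exact: reprK.
Qed.

Fact descent_zmod : zmod_morphism descent.
Proof.
move=> z1 z2; have [k [x [y [-> ->]]]] := cin_surj2 z1 z2.
by rewrite -rmorphB !descentE rmorphB.
Qed.
Fact descent_monoid : monoid_morphism descent.
Proof.
split; first by rewrite -[1]/cone descentE rmorph1.
move=> z1 z2; have [k [x [y [-> ->]]]] := cin_surj2 z1 z2.
by rewrite -rmorphM !descentE rmorphM.
Qed.
Fact descent_scalable : scalable descent.
Proof.
move=> a z; have [k [x ->]] := cin_surj z.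
by rewrite -linearZ !descentE linearZ.
Qed.
HB.instance Definition _ := GRing.isZmodMorphism.Build L B descent descent_zmod.
HB.instance Definition _ := GRing.isMonoidMorphism.Build L B descent descent_monoid.
HB.instance Definition _ := GRing.isScalable.Build A L B *:%R descent descent_scalable.
End Descent.

Section Colimit.
Variables (B : comAlgType A) (f : forall i, {lrmorphism F i -> B}).
Hypothesis f_colim : is_colimit f.

Lemma cin_cocone : is_cocone (fun i => @cin i : {lrmorphism F i -> L}).
Proof. by move=> i j p x; exact: cin_map. Qed.

(** The composite from [B] to the germs and back to [B] is the identity, by
    uniqueness in the universal property. *)
Lemma colimit_surj (w : B) : exists i (x : F i), w = f i x.
Proof.
have [f_cocone f_univ] := f_colim.
have [h hE _] := f_univ _ _ cin_cocone.
have [k _ kuniq] := f_univ _ _ f_cocone.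
pose D : {lrmorphism L -> B} := descent_of f_cocone.
have e1 : (D \o h : {lrmorphism B -> B}) =1 k.
  apply: kuniq => i x /=; have := hE i x => /= ->; exact: descentE.
have e2 : (idfun : {lrmorphism B -> B}) =1 k by apply: kuniq.
have [i [x ex]] := cin_surj (h w); exists i, x.
have := e2 w; rewrite -e1 /= ex => ->; exact: descentE.
Qed.

Lemma colimit_eq i (x y : F i) : f i x = f i y ->
  exists k (p : (i <= k)%O), sys_map F p x = sys_map F p y.
Proof.
have [f_cocone f_univ] := f_colim.
have [h hE _] := f_univ _ _ cin_cocone.
move=> e; have : cin x = cin y.
  by have := hE i x; have := hE i y => /= <- <-; rewrite e.
case/cin_eq=> k [p [q e']]; exists k, p; rewrite e'; exact: sys_map_irr.
Qed.
End Colimit.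
End FilteredColimit.

(** * Maximal ideals and value groups *)

(** Zorn's lemma for the proper ideals containing [w]; the principal ideal of
    [w] bounds the empty chain. *)
Lemma nonunit_in_max (A : comUnitRingType) (w : A) : w \isn't a GRing.unit ->
  exists2 m : {pred A}, maximal_ideal m & w \in m.
Proof.
move=> nw.
pose S (J : {pred A}) := `[< idealr_closed J /\ w \in J >].
pose R (J K : {pred A}) := `[< {subset J <= K} >].
pose J0 : {pred A} := [pred x | `[< exists a, x = a * w >]].
have J0P : J0 \in S.
  apply/asboolP; split; last by apply/asboolP; exists 1; rewrite mul1r.
  split.
  - by apply/asboolP; exists 0; rewrite mul0r.
  - apply/asboolP => -[a e]; move: nw; apply/negP/negPn.
    by apply/unitrP; exists a; rewrite [w * a]mulrC -e.
  - move=> a x y /asboolP[b ->] /asboolP[c ->]; apply/asboolP; exists (a * b + c).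
    by rewrite mulrDl mulrA.
have [||F FS /(@wochoice.wo_chainW {pred A}) totF|M MS Mmax] :=
    @wochoice.Zorn's_lemma {pred A} R S.
- by move=> J _; apply/asboolP.
- by move=> J K L _ _ _ /asboolP h1 /asboolP h2; apply/asboolP => x /h1 /h2.
- case: (pselect (exists J, J \in F)) => [[J1 FJ1]|nF]; last first.
    by exists J0 => // J FJ; case: nF; exists J.
  pose U : {pred A} := [pred x | `[< exists2 J, J \in F & x \in (J : {pred A}) >]].
  exists U; last by move=> J FJ; apply/asboolP => x Jx; apply/asboolP; exists J.
  have /asboolP[[I0 _ _] Iw] := FS _ FJ1.
  apply/asboolP; split; last by apply/asboolP; exists J1.
  split; first by apply/asboolP; exists J1.
    by apply/asboolP => -[J FJ J1']; have /asboolP[[_ /negP]] := FS _ FJ.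
  move=> a x y /asboolP[J FJ Jx] /asboolP[K FK Ky]; apply/asboolP.
  have /orP[] := totF J K FJ FK => /asboolP h.
    exists K => //; have /asboolP[[_ _ hK] _] := FS _ FK; apply: hK => //; exact: h.
  exists J => //; have /asboolP[[_ _ hJ] _] := FS _ FJ; apply: hJ => //; exact: h.
have /asboolP[MI Mw] := MS; exists M => //.
split=> // J JI MJ x; apply/idP/idP; last exact: MJ.
have JS : J \in S by apply/asboolP; split=> //; exact: MJ.
have /asboolP h : R J M by apply: Mmax => //; apply/asboolP.
exact: h.
Qed.

Lemma local_ring_unit (A : comUnitRingType) (n : {pred A}) : local_ring n ->
  forall x, (x \in n) = (x \isn't a GRing.unit).
Proof.
case=> [[[n0 n1 nlin] _] nuniq] x; apply/idP/idP => [nx|nu].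
  apply/negP => Ux; move: n1; rewrite -(mulVr Ux) => /negP; apply.
  by rewrite -[_ * _]addr0; exact: nlin.
by have [m' mm' m'x] := nonunit_in_max nu; rewrite -(nuniq m' mm').
Qed.

Lemma frac_rescale (K : fieldType) (a b u v : K) : u != 0 -> v != 0 ->
  a / b = v * u^-1 * (a * u / (b * v)).
Proof.
move=> u0 v0; rewrite invfM.
transitivity (a / b * (v / v) * (u / u)); first by rewrite !divff ?mulr1.
by move: (u^-1) (v^-1) (b^-1) => u' v' b'; ring.
Qed.

Section ValueGroups.
Variables (V W : idomainType) (j : {rmorphism V -> W}).
Hypothesis j_inj : injective j.
Hypothesis V_dvd : forall a b : V, (exists c, a = b * c) \/ (exists c, b = a * c).
Hypothesis j_local : forall a, j a \is a GRing.unit -> a \is a GRing.unit.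
Hypothesis j_content : forall y : W, y != 0 ->
  exists a u, u \is a GRing.unit /\ y = j a * u.

Local Notation phi := (value_group_map j).

Let F0 (A : idomainType) (c : A) : c != 0 -> c%:F != 0.
Proof. by rewrite tofrac_eq0. Qed.

Let j0 c : c != 0 -> j c != 0.
Proof. by rewrite -[in X in _ -> X](rmorph0 j) (inj_eq j_inj). Qed.

Lemma frac_rep (A : idomainType) (x : {fraction A}) :
  exists a b : A, b != 0 /\ x = a%:F / b%:F.
Proof.
by exists \n_(repr x), \d_(repr x); split; [exact: denom_ratioP | exact: fracE].
Qed.

Lemma frac_mapM x y : frac_map j (x * y) = frac_map j x * frac_map j y.
Proof.
have [a [b [b0 ->]]] := frac_rep x; have [c [d [d0 ->]]] := frac_rep y.
by rewrite mulf_div -!rmorphM !frac_mapE ?mulf_neq0 // !rmorphM mulf_div.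
Qed.

Lemma val_frac_map (x : {x : {fraction V} | x != 0}) :
  val (insubd (nzfrac1 W) (frac_map j (val x))) = frac_map j (val x).
Proof. by rewrite val_insubd frac_map_neq0 // (valP x). Qed.

(** For elements of [V] this says that divisibility in [W] implies divisibility
    in [V], which holds because [V] is a valuation ring and [j] reflects
    units. *)
Lemma frac_map_dvd (x y : {fraction V}) : x != 0 -> y != 0 ->
  (exists c : W, frac_map j y = c%:F * frac_map j x) -> exists c : V, y = c%:F * x.
Proof.
have [p [q [q0 ->]]] := frac_rep x; have [r [s [s0 ->]]] := frac_rep y.
move=> x0 y0 [c]; rewrite !frac_mapE // => e.
have r0 : r != 0 by apply: contraNneq y0 => ->; rewrite rmorph0 mul0r.
have key : j (r * q) = c * j (p * s).
  apply/eqP; rewrite -tofrac_eq !rmorphM /=.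
  move: e; rewrite mulrA => /eqP; rewrite eqr_div ?F0 ?j0 // => /eqP ->.
  by rewrite mulrA.
suff [d ed] : exists d, r * q = d * (p * s).
  exists d; rewrite mulrA; apply/eqP; rewrite eqr_div ?F0 // -!rmorphM tofrac_eq ed.
  by rewrite mulrA.
have [[d ->]|[d ed]] := V_dvd (r * q) (p * s); first by exists d; rewrite mulrC.
have Ud : d \is a GRing.unit.
  apply: j_local; apply/unitrP; exists c.
  have : j (r * q) * (c * j d) = j (r * q) * 1.
    by rewrite mulr1 [RHS]key ed (rmorphM j (r * q)) mulrCA.
  by move/(mulfI (j0 (mulf_neq0 r0 q0))) => h; rewrite [j d * c]mulrC.
by exists d^-1; rewrite ed [RHS]mulrC mulrK.
Qed.

(** An embedding of ordered groups by [frac_map_dvd]; surjective because a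
    fraction of [W] differs by a unit from the fraction of the contents. *)
Lemma value_group_map_iso : ordered_group_iso phi.
Proof.
have mono : {mono phi : a b / vle a b}.
  move=> a b; elim/vclassW: b => y; elim/vclassW: a => x.
  rewrite !value_group_mapE //; apply/idP/idP => [/vle_pi[c]|/vle_pi[c e]].
    rewrite !val_frac_map => e; apply/vle_pi.
    by apply: (frac_map_dvd (valP x) (valP y)); exists c.
  apply/vle_pi; exists (j c); rewrite !val_frac_map e frac_mapM; congr (_ * _).
  have -> : c%:F = c%:F / (1 : V)%:F by rewrite rmorph1 divr1.
  by rewrite frac_mapE ?oner_eq0 // !rmorph1 divr1.
have anti (a b : value_group V) : vle a b -> vle b a -> a = b.
  elim/vclassW: b => y; elim/vclassW: a => x.
  move=> /vle_pi[c ey] /vle_pi[d ex]; apply/vclass_eq/asboolP; exists d => //.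
  apply/unitrP; exists c; suff e1 : c * d = 1 by rewrite [d * c]mulrC.
  apply/eqP; rewrite -tofrac_eq; apply/eqP.
  apply: (mulIf (valP x)); rewrite rmorph1 mul1r [RHS]ex ey rmorphM /= mulrA.
  by rewrite [d%:F * _]mulrC.
have inj : injective phi.
  have vlexx (c : value_group V) : vle c c.
    by elim/vclassW: c => y; apply/vle_pi; exists 1; rewrite rmorph1 mul1r.
  by move=> a b e; apply: anti; rewrite -mono e mono; exact: vlexx.
have surj : forall b, exists a, phi a = b.
  elim/vclassW=> y; have [p [q [q0 ey]]] := frac_rep (val y).
  have p0 : p != 0.
    by apply/eqP => p0; have := valP y; rewrite ey p0 rmorph0 mul0r eqxx.
  have [a [u [Uu ep]]] := j_content p0; have [b [v [Uv eq]]] := j_content q0.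
  have a0 : a != 0.
    by apply/eqP => a0; move: p0; rewrite ep a0 rmorph0 mul0r eqxx.
  have b0 : b != 0.
    by apply/eqP => b0; move: q0; rewrite eq b0 rmorph0 mul0r eqxx.
  have x0 : a%:F / b%:F != 0 by rewrite mulf_neq0 ?invr_eq0 ?F0.
  pose x : {x : {fraction V} | x != 0} := exist _ (a%:F / b%:F) x0.
  exists (vclass x); rewrite value_group_mapE //.
  apply/vclass_eq/asboolP; exists (v / u); first by rewrite unitrMl // unitrV.
  rewrite val_frac_map /= frac_mapE // ey ep eq !rmorphM /=.
  have Fu (w : W) : w \is a GRing.unit -> w%:F != 0.
    by move=> Uw; rewrite tofrac_eq0; apply: contraTneq Uw => ->; rewrite unitr0.
  have -> : (u^-1)%:F = (u%:F)^-1.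
    by apply: (mulIf (Fu u Uu)); rewrite mulVf ?Fu // -rmorphM mulVr ?rmorph1.
  by apply: frac_rescale; exact: Fu.
split=> //.
  have [g gK] := choice surj; exists g => // a.
  by apply: inj; rewrite gK.
move=> a b; rewrite -[(a * b)%g]/(vmul a b) -[RHS]/(vmul _ _).
elim/vclassW: b => y; elim/vclassW: a => x.
rewrite vmul_pi !value_group_mapE // vmul_pi; congr vclass; apply: val_inj.
rewrite [LHS]val_frac_map /= frac_mapM; congr (_ * _); symmetry; exact: val_frac_map.
Qed.
End ValueGroups.

Lemma dvd_valuation_ring (D : idomainType) :
  (forall a b : D, (exists c, a = b * c) \/ (exists c, b = a * c)) ->
  valuation_ring D.
Proof.
move=> Dd x x0; have [a [b [b0 ex]]] := frac_rep x.
have a0 : a != 0 by apply: contraNneq x0 => a0; rewrite ex a0 rmorph0 mul0r.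
have F0 (c : D) : c != 0 -> c%:F != 0 by rewrite tofrac_eq0.
have [[c e]|[c e]] := Dd a b; [left | right]; exists c.
  by rewrite ex e rmorphM /= mulrC mulKf ?F0.
by rewrite ex invf_div e rmorphM /= mulrC mulKf ?F0.
Qed.

(** * The theorem *)

(** The case [mu = 0] of [flat_relation]: the ideal [(0 : a)] is zero. *)
Lemma flat_torsionfree (V : idomainType) (M : lmodType V) : flat M ->
  forall (a : V) (x : M), a *: x = 0 -> a = 0 \/ x = 0.
Proof.
move=> flatM a x e; case: (eqVneq a 0) => [|a0]; [by left | right].
have /(flat_relation flatM) : a *: x = (0 : V) *: 0 by rewrite e scaler0.
move=> h; apply: (h (fun x => x = 0)).
  by split=> // v y z -> ->; rewrite scaler0 addr0.
move=> c z [b /eqP]; rewrite mul0r mulf_eq0 (negPf a0) => /eqP->.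
by rewrite scale0r.
Qed.

Section Colimit.
Variables (V : idomainType) (m : {pred V}).
Hypotheses (V_val : valuation_ring V) (V_max : maximal_ideal m).
Variables (W : comUnitAlgType V) (n : {pred W}).
Hypothesis torsionfree : forall (a : V) (x : W), a *: x = 0 -> a = 0 \/ x = 0.
Hypothesis n_unit : forall x, (x \in n) = (x \isn't a GRing.unit).
Hypothesis n_max : forall w, w \in n <-> exists mu w', mu \in m /\ w = mu *: w'.
Variables (d : Order.disp_t) (I : preorderType d) (I_filtered : filtered I).
Variable R : inductive_system V I.
Hypothesis R_eft : forall i : I, ess_finite_type (R i).
Hypothesis u_flat :
  forall (i j : I) (le_ij : (i <= j)%O), flat_hom (sys_map R le_ij).
Variable f : forall i : I, {lrmorphism R i -> W}.
Hypothesis W_colim : is_colimit f.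

(** The equation [f i r = mu w] already holds at a later index [l].  By flatness
    of [R l] over [R i], the ideal [(mu : r)] of [R i] generates the unit ideal
    of [R l], hence of [W], so it contains some [a] that is a unit in [W]. *)
Lemma locally_in_max i (r : R i) : f i r \in n ->
  exists (mu : V) (a b : R i), [/\ mu \in m, f i a \notin n & r * a = mu *: b].
Proof.
have [f_cocone _] := W_colim.
case/n_max=> mu [w [mmu ew]].
have [j [w1 ew1]] := colimit_surj I_filtered W_colim w.
have [k [ik jk]] : exists k : I, (i <= k)%O /\ (j <= k)%O.
  by case: I_filtered => _; apply.
have e : f k (sys_map R ik r) = f k (mu *: sys_map R jk w1).
  have := f_cocone _ _ ik r; have := f_cocone _ _ jk w1 => /= e1 e2.
  by rewrite linearZ /= e1 e2 ew ew1.
have [l [kl e']] := colimit_eq I_filtered W_colim e.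
have il := Order.le_trans ik kl.
set y := sys_map R kl (sys_map R jk w1).
have er : sys_map R il r = mu *: y.
  by rewrite -(sys_mapK ik kl) e' linearZ.
pose M := restr_scalars (sys_map R il).
have rel : r *: (1 : M) = (mu%:A : R i) *: (y : M).
  rewrite -[LHS]/(sys_map R il r * 1) -[RHS]/(sys_map R il mu%:A * y).
  by rewrite mulr1 er rmorph_alg mulr_algl.
have h1 := flat_relation (@u_flat _ _ il) rel.
apply: contrapT => H.
have : f l 1 \in n.
  apply: (h1 (fun x => f l x \in n)).
    split; first by rewrite rmorph0 n_unit unitr0.
    move=> v x1 x2 n1 n2.
    have -> : f l (v *: (x1 : M) + x2) = f l (sys_map R il v) * f l x1 + f l x2.
      by rewrite -rmorphM -rmorphD.
    apply: (max_extD V_val n_max) => //; exact: (nonunitM n_unit).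
  move=> a z [b eb].
  have -> : f l (a *: (z : M)) = f l z * f i a.
    by rewrite -(f_cocone _ _ il a) /= mulrC -rmorphM.
  apply: (nonunitM n_unit); apply: contrapT => /negP na; apply: H.
  by exists mu, a, b; split=> //; rewrite eb mulr_algl.
by rewrite rmorph1 n_unit unitr1.
Qed.

(** Apply [content] to the image in [W] of a finite type algebra of which some
    [R i] is a localization; up to a unit, [x] lies in this image. *)
Theorem colimit_content (x : W) : x != 0 ->
  exists b u, u \is a GRing.unit /\ x = b *: u.
Proof.
have [i [r ex]] := colimit_surj I_filtered W_colim x.
have [C [Sc [phi [[gens gensP] [Sc1 ScM] [phi_unit phi_frac phi_eq]]]]] := R_eft i.
pose g c : W := f i (phi c).
have gunit s : s \in Sc -> g s \is a GRing.unit.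
  move=> /phi_unit[b e]; apply/unitrP; exists (f i b).
  by rewrite /g [_ * f i b]mulrC -rmorphM e rmorph1.
have gM a b : g (a * b) = g a * g b by rewrite /g !rmorphM.
have gP v a b : g (v *: a + b) = v *: g a + g b by rewrite /g !linearP.
have g1 : g 1 = 1 by rewrite /g !rmorph1.
have [||||S [fS fgS nS Sgens SD]] :=
    @generated_filtration V m V_val V_max W (map g gens) (fun w => exists c, w = g c).
- by exists 1; rewrite g1.
- by move=> v _ _ [a ->] [b ->]; exists (v *: a + b); rewrite gP.
- by move=> _ _ [a ->] [b ->]; exists (a * b); rewrite gM.
- by move=> _ /mapP[c _ ->]; exists c.
have gS c : exists e, S e (g c).
  suff : c \in [pred c | `[< exists e, S e (g c) >]] by move/asboolP.
  apply: gensP => [|a ga]; last first.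
    by apply/asboolP; exists 1%N; apply: Sgens; exact: map_f.
  split.
  - by apply/asboolP; exists 0%N; rewrite g1; exact: filt1.
  - move=> v a b /asboolP[e1 h1] /asboolP[e2 h2]; apply/asboolP.
    exists (maxn e1 e2); rewrite gP; case: (filt_submod fS (maxn e1 e2)) => _; apply.
      by apply: (filt_le fS) h1; exact: leq_maxl.
    by apply: (filt_le fS) h2; exact: leq_maxr.
  - move=> a b /asboolP[e1 h1] /asboolP[e2 h2]; apply/asboolP.
    by exists (e1 + e2)%N; rewrite gM; exact: (filtM fS).
have n_mulU a u : u \is a GRing.unit -> a \notin n -> a * u \notin n.
  by move=> Uu; rewrite !n_unit !negbK unitrMl.
have S_loc e z : S e z -> z \in n ->
    exists e' s, [/\ S e' s, s \notin n & max_mul m S (e' + e)%N (s * z)].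
  move=> Sz nz; have [c ez] := SD _ _ Sz; rewrite ez in nz *.
  have [mu [a [b [mmu na eab]]]] := locally_in_max nz.
  have [c1 [s1 [Ss1 e1]]] := phi_frac a; have [c2 [s2 [Ss2 e2]]] := phi_frac b.
  have [k1 h1] := gS (c1 * s2); have [k2 h2] := gS (c2 * s1).
  exists (maxn k1 k2), (g (c1 * s2)); split.
  - by apply: (filt_le fS) h1; exact: leq_maxl.
  - rewrite gM; apply: (n_mulU); first exact: gunit.
    by rewrite /g -e1 rmorphM; apply: n_mulU => //; exact: gunit.
  - exists mu, (g (c2 * s1)); split=> //.
      apply: (filt_le fS) h2; apply: leq_trans (leq_addr _ _); exact: leq_maxr.
    rewrite !gM /g -e1 -e2 -!rmorphM -linearZ; congr (f i _).
    rewrite scalerAl scalerAl -eab; ring.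
move=> x0; have [c [s [Ss ec]]] := phi_frac r.
have [h Sh] := gS c.
have Us := gunit s Ss.
have exs : x * g s = g c by rewrite ex /g -rmorphM ec.
have gc0 : g c != 0.
  by rewrite -exs; apply: contra x0 => /eqP e; rewrite -(mulrK Us x) e mul0r.
have [b [u [Uu e]]] := content V_val V_max torsionfree n_unit n_max fS fgS nS S_loc Sh gc0.
exists b, (u / g s); split; first by rewrite unitrMl // unitrV.
by rewrite scalerAl -e -exs mulrK.
Qed.
End Colimit.

Lemma unit_rescale (A : comUnitRingType) (b c u v : A) : v \is a GRing.unit ->
  b * c * u = b * v * (c * u / v).
Proof.
move=> Uv; transitivity (b * c * u * (v / v)); first by rewrite divrr ?mulr1.
by move: (v^-1) => v'; ring.
Qed.

Lemma content_unramified (V : idomainType) (m : {pred V})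
    (W : comUnitAlgType V) (n : {pred W}) :
  valuation_ring V -> maximal_ideal m ->
  (forall (a : V) (x : W), a *: x = 0 -> a = 0 \/ x = 0) ->
  (forall x : W, (x \in n) = (x \isn't a GRing.unit)) ->
  (forall n' : {pred W}, maximal_ideal n' -> n' =i n) ->
  (forall w : W, w \in n <-> exists mu w', mu \in m /\ w = mu *: w') ->
  (forall x : W, x != 0 -> exists b u, u \is a GRing.unit /\ x = b *: u) ->
  exists W_dom : GRing.integral_domain_axiom W,
    weakly_unramified
      (GRing.in_alg W : {rmorphism V -> idomain_of W_dom}).
Proof.
move=> Vv Vm tf nu nuniq nm cW.
have Wdom : GRing.integral_domain_axiom W.
  move=> x y exy; apply/norP => -[x0 y0].
  have [a [u [Uu ex]]] := cW x x0; have [b [v [Uv ey]]] := cW y y0.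
  move: exy; rewrite ex ey -scalerAl -scalerAr => /tf[a0|/tf[b0|uv0]].
  - by move: x0; rewrite ex a0 scale0r eqxx.
  - by move: y0; rewrite ey b0 scale0r eqxx.
  - by have : u * v \is a GRing.unit; [rewrite unitrMl | rewrite uv0 unitr0].
exists Wdom; set j : {rmorphism V -> idomain_of Wdom} := GRing.in_alg W.
have j_inj : injective j.
  move=> a b e; apply/eqP; rewrite -subr_eq0; apply/eqP.
  have /tf[//|/eqP] : (a - b) *: (1 : W) = 0.
    by rewrite scalerBl; apply/eqP; rewrite subr_eq0; apply/eqP.
  by rewrite oner_eq0.
have j_max a : a \in m -> (j a : W) \in n by move=> ma; apply/nm; exists a, 1.
have j_content (y : idomain_of Wdom) : y != 0 ->
    exists a u, u \is a GRing.unit /\ y = j a * u.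
  move=> y0; have [a [u [Uu ey]]] := cW y y0; exists a, u; split=> //.
  by rewrite -[RHS]/((a *: (1 : W)) * u) mulr_algl.
split; last first.
  apply: value_group_map_iso => //; first exact: dvd_total Vv.
  move=> a Ua; apply/negPn; rewrite -(max_unit Vv Vm); apply/negP => /j_max.
  by rewrite nu -[_ \is a _]/(j a \is a GRing.unit) Ua.
split=> //.
- apply: dvd_valuation_ring => x y.
  case: (eqVneq x 0) => [->|x0]; first by left; exists 0; rewrite mulr0.
  case: (eqVneq y 0) => [->|y0]; first by right; exists 0; rewrite mulr0.
  have [a [u [Uu ex]]] := j_content x x0; have [b [v [Uv ey]]] := j_content y y0.
  have [[c ec]|[c ec]] := dvd_total Vv a b; [left; exists (j c * u / v) | right; exists (j c * v / u)].
    by rewrite ex ey ec rmorphM; exact: unit_rescale.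
  by rewrite ex ey ec rmorphM; exact: unit_rescale.
- move=> m' n' mm' mn' a m'a.
  have ->: (j a \in n') = ((j a : W) \in n) by exact: (nuniq n' mn').
  by apply: j_max; rewrite (max_unit Vv Vm) -(max_unit Vv mm').
Qed.

Theorem mainTheorem1
  (V : idomainType) (m : {pred V})
  (V_val : valuation_ring V) (V_max : maximal_ideal m)
  (W : comUnitAlgType V) (n : {pred W})
  (W_local : local_ring n) (W_flat : flat W)
  (n_eq_mW : forall w : W, w \in n <-> in_extended_ideal m w)
  (d : Order.disp_t) (I : preorderType d) (I_filtered : filtered I)
  (R : inductive_system V I)
  (R_flat : forall i : I, flat (R i))
  (R_eft : forall i : I, ess_finite_type (R i))
  (u_flat : forall (i j : I) (le_ij : (i <= j)%O), flat_hom (sys_map R le_ij))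
  (f : forall i : I, {lrmorphism R i -> W})
  (W_colim : is_colimit f) :
  exists W_dom : GRing.integral_domain_axiom W,
    weakly_unramified
      (GRing.in_alg W : {rmorphism V -> idomain_of W_dom}).
Proof.
have n_unit := local_ring_unit W_local.
have tf := flat_torsionfree W_flat.
have n_max (w : W) : w \in n <-> exists mu w', mu \in m /\ w = mu *: w'.
  rewrite n_eq_mW; split=> [[s [ms ->]]|[mu [w' [mmu ->]]]]; last first.
    by exists [:: (mu, w')]; rewrite /= mmu big_seq1.
  elim: s ms => [_|[a x] s IHs /= /andP[ma /IHs[b [y [mb e]]]]].
    by exists 0, 0; rewrite big_nil scaler0; split=> //; exact: max0 V_max.
  have [t mt [[a' ->] [b' eb]]] := max_gcd V_val ma mb.
  exists t, (a' *: x + b' *: y); split=> //.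
  by rewrite big_cons e eb /= scalerDr !scalerA.
apply: (content_unramified V_val V_max tf n_unit _ n_max); first by case: W_local.
exact: (colimit_content V_val V_max tf n_unit n_max I_filtered R_eft u_flat W_colim).
Qed.
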